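(* Let $A$ be a unital Banach algebra with unit $1_A$, let $(C(t))_{t\in\mathbb{R}}$ be a cosine function in $A$ (i.e. $C(0)=1_A$ and $C(s+t)+C(s-t)=2C(s)C(t)$ for all $s,t\in\mathbb{R}$; no continuity is assumed), and let $A_1$ be the closed subalgebra of $A$ generated by $\{C(t):t\in\mathbb{R}\}$. For $a\in\mathbb{R}$ and $m\ge0$ let $\Omega(a,m)=\{b\ge0:\ \sup_{t\in\mathbb{R}}|\cos(ta)-\cos(tb)|\le m\}$. (i) If $m:=\sup_{t\in\mathbb{R}}\Vert C(t)-\cos(at)1_A\Vert<2$ for some $a\in\mathbb{R}$, then $A_1$ is isomorphic to $\mathbb{C}^k$ for some $k\le\mathrm{card}(\Omega(a,m))$, and there exist pairwise orthogonal idempotents $p_1,\dots,p_k$ of $A_1$ and distinct elements $b_1,\dots,b_k$ of $\Omega(a,m)$ such that $C(t)=\sum_{j=1}^k\cos(b_jt)p_j$ for all $t\in\mathbb{R}$. (ii) If $\sup_{t\in\mathbb{R}}\Vert C(t)-\cos(at)1_A\Vert<\frac{8}{3\sqrt3}$ for some $a\in\mathbb{R}$, then $C(t)=\cos(at)1_A$ for all $t\in\mathbb{R}$. *)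

(* Defs.v *)
From HB Require Import structures.
From mathcomp Require Import all_boot all_order all_algebra.
From mathcomp Require Import all_classical all_reals all_analysis.
From mathcomp Require Import complex.
Set Implicit Arguments. Unset Strict Implicit. Unset Printing Implicit Defensive.
Import Order.TTheory GRing.Theory Num.Theory.
Import numFieldNormedType.Exports.
Local Open Scope ring_scope.
Local Open Scope classical_set_scope.

Notation Cplx R := (complex.complex R).

(* A unital Banach algebra structure on a complete normed K-space A:
   (HB cannot join the ring and normed-module hierarchies, so the product
   and the unit are given explicitly together with their axioms). *)
Record banach_algebra (K : numFieldType) (A : completeNormedModType K) := {
  bmul : A -> A -> A;
  bone : A;
  bmulA : forall x y z, bmul x (bmul y z) = bmul (bmul x y) z;
  bmulDl : forall x y z, bmul (x + y) z = bmul x z + bmul y z;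
  bmulDr : forall x y z, bmul x (y + z) = bmul x y + bmul x z;
  bmulZl : forall (c : K) x y, bmul (c *: x) y = c *: bmul x y;
  bmulZr : forall (c : K) x y, bmul x (c *: y) = c *: bmul x y;
  bmul1l : forall x, bmul bone x = x;
  bmul1r : forall x, bmul x bone = x;
  bnorm_mul : forall x y, `|bmul x y| <= `|x| * `|y|;
  bnorm_one : `|bone| = 1
}.

Section Defs.
Variables (R : realType) (A : completeNormedModType (Cplx R)).
Variable B : banach_algebra A.
Local Notation "x *b y" := (bmul B x y) (at level 40, left associativity).
Local Notation one := (bone B).

Definition is_cosine_function (C : R -> A) : Prop :=
  C 0 = one /\ (forall s t : R, C (s + t) + C (s - t) = (C s *b C t) *+ 2).

Definition is_subalgebra (S : set A) : Prop :=
  S one /\ (forall x y, S x -> S y -> S (x + y)) /\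
  (forall (c : Cplx R) x, S x -> S (c *: x)) /\
  (forall x y, S x -> S y -> S (x *b y)).

Definition closed_subalg_gen (G : set A) : set A :=
  [set x | forall S : set A, closed S -> is_subalgebra S -> G `<=` S -> S x].

Definition alg_iso_onto (k : nat) (f : 'rV[Cplx R]_k -> A) (S : set A) : Prop :=
  (forall u v, f (u + v) = f u + f v) /\
  (forall (c : Cplx R) u, f (c *: u) = c *: f u) /\
  (forall u v : 'rV[Cplx R]_k, f (\row_i (u 0 i * v 0 i)%R) = f u *b f v) /\
  f (const_mx 1%R) = one /\
  injective f /\ range f = S.

Definition orth_idempotents (k : nat) (p : 'I_k -> A) : Prop :=
  (forall j, p j *b p j = p j) /\ (forall i j, i != j -> p i *b p j = 0).

End Defs.

Definition Omega (R : realType) (a m : R) : set R :=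
  [set b | 0 <= b /\ forall t : R, `|cos (t * a) - cos (t * b)| <= m].

(* Main.v *)
(* If C stays within m < 2 of cos(a t), then |1 - C(s)| <= m' < 2 whenever cos(a s) is
   close to 1.  A scalar cos(x) whose multiples cos(n x) avoid a neighbourhood of -1 has
   x close to a rational multiple of 2 pi with bounded denominator; hence for a suitable
   integer k the spectrum of 1 - C(k s) lies in the open unit disc and its powers are
   bounded.  The quadratic equation relating 1 - C(t) to 1 - C(2 t) then gives
   |1 - C(t)| <= |1 - C(2 t)| / 2 for t = k s.  Applied to small t this yields norm
   continuity of C; applied to 2^j k tau, where a tau is a multiple of 2 pi, it yields
   C(k tau) = 1, so C is periodic.  A finite Fourier transform of C over a fine
   subdivision of the period produces finitely many orthogonal eigenprojections p_j, with
   C(t) p_j = cos(b_j t) p_j, first for one small t, then for all t by halving and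
   continuity.  Part (ii) follows since sup_t |cos(a t) - cos(b t)| >= 8 / (3 sqrt 3)
   when |a| <> |b|. *)
Require Import Defs.
From HB Require Import structures.
From mathcomp Require Import all_boot all_order all_algebra.
From mathcomp Require Import all_classical all_reals all_analysis.
From mathcomp Require Import complex.
From mathcomp Require Import ring lra.
Import Order.TTheory GRing.Theory Num.Theory.
Import numFieldNormedType.Exports.
Local Open Scope ring_scope.
Local Open Scope classical_set_scope.

(** * Real norm and Neumann series *)

(* The ring structure is put on this alias of A: HB cannot join it to the normed
   module structure carried by A itself. *)
Definition balg (R : realType) (A : completeNormedModType (Cplx R))
  (B : banach_algebra A) : Type := A.

Section BanachAlgebra.
Context {R : realType} {A : completeNormedModType (Cplx R)}.
Variable B : banach_algebra A.
Local Notation AB := (balg R A B).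

HB.instance Definition _ := GRing.Lmodule.copy AB A.

Lemma bone_neq0 : bone B != 0 :> A.
Proof. by rewrite -normr_eq0 bnorm_one oner_eq0. Qed.

HB.instance Definition _ := GRing.Zmodule_isNzRing.Build AB
  (@bmulA _ _ B) (@bmul1l _ _ B) (@bmul1r _ _ B)
  (@bmulDl _ _ B) (@bmulDr _ _ B) bone_neq0.

Lemma bscaleAl (c : Cplx R) (x y : AB) : c *: (x * y) = (c *: x) * y.
Proof. by rewrite -[RHS]/(bmul B (c *: x) y) bmulZl. Qed.

HB.instance Definition _ :=
  GRing.Lmodule_isLalgebra.Build (Cplx R) AB bscaleAl.

Lemma bscaleAr (c : Cplx R) (x y : AB) : c *: (x * y) = x * (c *: y).
Proof. by rewrite -[RHS]/(bmul B x (c *: y)) bmulZr. Qed.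

HB.instance Definition _ :=
  GRing.Lalgebra_isAlgebra.Build (Cplx R) AB bscaleAr.

Lemma scaler_mulACA (c d : Cplx R) (x y : AB) :
  (c *: x) * (d *: y) = (c * d) *: (x * y).
Proof. by rewrite -bscaleAl -bscaleAr scalerA. Qed.

End BanachAlgebra.

Section RealNorm.
Context {R : realType} {A : completeNormedModType (Cplx R)}.
Context {B : banach_algebra A}.
Local Notation AB := (balg R A B).

(** The norm of [A] takes values in [Cplx R], which is only partially ordered; being real, it equals
    its real part, and estimates can be made in [R]. *)
Definition rnorm (x : AB) : R := complex.Re `|x : A|.

Lemma rnormE (x : AB) : `|x : A| = (rnorm x)%:C%C.
Proof.
have := normr_ge0 (x : A); rewrite /rnorm; case: `|_ : A| => a b.
by rewrite lecE /= => /andP[/eqP -> _].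
Qed.

Lemma rnorm_le (x : AB) (m : R) : (`|x : A| <= m%:C%C) = (rnorm x <= m).
Proof. by rewrite rnormE lecR. Qed.

Lemma rnorm_ge0 (x : AB) : 0 <= rnorm x.
Proof. by rewrite -ler0c -rnormE normr_ge0. Qed.
Hint Resolve rnorm_ge0 : core.

Lemma rnorm0 : rnorm 0 = 0.
Proof. by rewrite /rnorm normr0. Qed.

Lemma rnorm_eq0 (x : AB) : rnorm x = 0 -> x = 0.
Proof. by move=> x0; apply/eqP; rewrite -(normr_eq0 (x : A)) rnormE x0. Qed.

Lemma rnormD (x y : AB) : rnorm (x + y) <= rnorm x + rnorm y.
Proof. by rewrite -lecR rmorphD /= -!rnormE ler_normD. Qed.

Lemma rnormN (x : AB) : rnorm (- x) = rnorm x.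
Proof. by rewrite /rnorm (normrN (x : A)). Qed.

Lemma rnormB (x y : AB) : rnorm (x - y) <= rnorm x + rnorm y.
Proof. by rewrite -(rnormN y) rnormD. Qed.

Lemma rdistC (x y : AB) : rnorm (x - y) = rnorm (y - x).
Proof. by rewrite -rnormN opprB. Qed.

Lemma rnormZ (c : Cplx R) (x : AB) : rnorm (c *: x) = Normc.normc c * rnorm x.
Proof. by apply: complexI; rewrite rmorphM /= -!rnormE normrZ. Qed.

Lemma rnormZr (c : R) (x : AB) : rnorm (c%:C%C *: x) = `|c| * rnorm x.
Proof. by rewrite rnormZ /= expr0n /= addr0 sqrtr_sqr. Qed.

Lemma rnormM (x y : AB) : rnorm (x * y) <= rnorm x * rnorm y.
Proof. by rewrite -lecR rmorphM /= -!rnormE bnorm_mul. Qed.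

Lemma rnorm1 : rnorm 1 = 1.
Proof. by rewrite /rnorm bnorm_one. Qed.

Lemma rnormX (x : AB) n : rnorm (x ^+ n) <= rnorm x ^+ n.
Proof.
elim: n => [|n IH]; first by rewrite !expr0 rnorm1.
by rewrite !exprS (le_trans (rnormM _ _))// ler_wpM2l.
Qed.

Lemma rnorm_small0 (x : AB) (M : R) :
  (forall e : R, 0 < e -> rnorm x <= M * e) -> x = 0.
Proof.
move=> xM; apply: rnorm_eq0; apply/eqP; rewrite eq_le rnorm_ge0 andbT.
rewrite leNgt; apply/negP => x0.
have M0 : 0 < M by have := xM 1 ltr01; rewrite mulr1; exact: lt_le_trans.
have e0 : 0 < rnorm x / (2 * M) by rewrite divr_gt0 ?mulr_gt0.
have := xM _ e0.
rewrite invfM mulrCA [M * _]mulrCA divff ?gt_eqF // mulr1.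
by lra.
Qed.

Lemma rnorm_complete (u : nat -> AB) :
  (forall e : R, 0 < e -> exists n0, forall n m, (n0 <= n)%N -> (n0 <= m)%N ->
    rnorm (u n - u m) < e) ->
  exists l : AB, forall e : R, 0 < e -> exists n0, forall n, (n0 <= n)%N ->
    rnorm (u n - l) < e.
Proof.
move=> uC; pose v : nat -> A := u.
have /cauchy_cvgP/cvg_ex[l vl] : cauchy (v @ \oo).
  apply: cauchy_exP => e e0.
  have [re eE] : exists re : R, e = re%:C%C.
    exists (complex.Re e); move: e0; rewrite ltcE /= => /andP[/eqP i0 _].
    by rewrite -complexr0 -i0; case: (e).
  move: e0; rewrite eE ltcR => e0.
  have [n0 un0] := uC _ e0.
  exists (v n0), n0 => // n n0n /=.
  rewrite -ball_normE /ball_ /=.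
  by have := un0 _ _ (leqnn n0) n0n; rewrite -ltcR -rnormE.
exists l => e e0.
have /cvgrPdist_lt /(_ e%:C%C) := vl; rewrite ltcR => /(_ e0) [n0 _ vn0].
exists n0 => n n0n; rewrite rdistC -ltcR -rnormE; exact: vn0 n n0n.
Qed.

Lemma rnorm_closed (S : set A) :
  (forall x : AB, (forall e : R, 0 < e -> exists2 y : AB, S y & rnorm (x - y) < e) ->
    S x) -> closed S.
Proof.
move=> HS x Sx; apply: HS => e e0.
have e0C : 0 < e%:C%C :> Cplx R by rewrite ltcR.
have [y [Sy]] := Sx _ (nbhsx_ballx x _ e0C).
rewrite -ball_normE /ball_ /= => xy.
by exists y => //; rewrite -ltcR -rnormE.
Qed.

End RealNorm.
#[global] Hint Extern 0 (is_true (0 <= rnorm _)) => exact: rnorm_ge0 : core.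

Lemma expr_small {R : realType} (r e : R) : 0 <= r < 1 -> 0 < e ->
  exists n0, forall n, (n0 <= n)%N -> r ^+ n < e.
Proof.
move=> /andP[r0 r1] e0.
have /cvgrPdist_lt/(_ _ e0)[n0 _ H] : (r ^+ n @[n --> \oo] --> 0)%classic.
  by apply: cvg_expr; rewrite ger0_norm.
exists n0 => n /H /=; rewrite sub0r normrN; apply: le_lt_trans; exact: ler_norm.
Qed.

Lemma normcB {R : realType} (z w : Cplx R) :
  Normc.normc (z - w) <= Normc.normc z + Normc.normc w.
Proof. by rewrite (le_trans (le_normcD z (- w : Rcomplex R)))// normcN. Qed.

Lemma normcr {R : realType} (a : R) : Normc.normc a%:C%C = `|a|.
Proof. by rewrite /= expr0n /= addr0 sqrtr_sqr. Qed.

Lemma normc_ge0 {R : realType} (z : Cplx R) : 0 <= Normc.normc z.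
Proof. by case: z => a b; exact: sqrtr_ge0. Qed.
#[global] Hint Extern 0 (is_true (0 <= Normc.normc _)) => exact: normc_ge0 : core.

Lemma normcX {R : realType} (z : Cplx R) n :
  Normc.normc (z ^+ n) = Normc.normc z ^+ n.
Proof.
elim: n => [|n IH]; first by rewrite !expr0 Normc.normc1.
by rewrite !exprS Normc.normcM IH.
Qed.

Section Invertible.
Context {R : realType} {A : completeNormedModType (Cplx R)}.
Context {B : banach_algebra A}.
Local Notation AB := (balg R A B).
Implicit Types x y g : AB.

Definition inverses (x y : AB) := x * y = 1 /\ y * x = 1.
Definition invertible (x : AB) := exists y, inverses x y.

Lemma inversesM x y g h : inverses x g -> inverses y h -> inverses (x * y) (h * g).
Proof.
move=> [xg gx] [yh hy]; split.
  by rewrite mulrA -(mulrA x) yh mulr1.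
by rewrite mulrA -(mulrA h) gx mulr1.
Qed.

Lemma invertibleM x y : invertible x -> invertible y -> invertible (x * y).
Proof. by move=> [g xg] [h yh]; exists (h * g); exact: inversesM. Qed.

Lemma invertibleZ (c : Cplx R) x : c != 0 -> invertible x -> invertible (c *: x).
Proof.
move=> c0 [g [xg gx]]; exists (c^-1 *: g); split.
  by rewrite -scalerAl -scalerAr scalerA mulfV // xg scale1r.
by rewrite -scalerAl -scalerAr scalerA mulVf // gx scale1r.
Qed.

(** [y * g] is a right inverse of [x] and, by commutation, [g * y] is a left one; the two then
    coincide. *)
Lemma invertible_commM x y : x * y = y * x -> invertible (x * y) -> invertible x.
Proof.
move=> xy [g [xyg gxy]]; exists (y * g); split; first by rewrite mulrA.
have gyx : g * y * x = 1 by rewrite -mulrA -xy.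
suff -> : y * g = g * y by [].
by rewrite -[LHS]mul1r -gyx -!mulrA (mulrA x) xyg mulr1.
Qed.

(** The partial sums [u n] of the geometric series are Cauchy, and [(1 - x) * u n = 1 - x ^+ n]
    passes to the limit. The bound on [g] is the tail bound taken from the empty sum [u 0]. *)
Lemma neumann x (r : R) : rnorm x <= r -> r < 1 ->
  exists2 g, inverses (1 - x) g & rnorm g <= (1 - r)^-1.
Proof.
move=> xr r1; have r0 : 0 <= r by exact: le_trans (rnorm_ge0 x) xr.
have d0 : 0 < 1 - r by rewrite subr_gt0.
pose u n := \sum_(i < n) x ^+ i.
have xu n : (1 - x) * u n = 1 - x ^+ n.
  by rewrite -[1 - x]opprB -[RHS]opprB subrX1 mulNr.
have ux n : u n * (1 - x) = 1 - x ^+ n.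
  rewrite -xu; apply: esym; apply: commr_sum => i _; apply: commrX.
  by apply: commr_sym; apply: commrB; [exact: commr1 | exact: commr_refl].
have xn n : rnorm (x ^+ n) <= r ^+ n.
  by apply: (le_trans (rnormX _ _)); apply: lerXn2r; rewrite ?nnegrE.
have duk m k : rnorm (u (m + k)%N - u m) <= (r ^+ m - r ^+ (m + k)) / (1 - r).
  elim: k => [|k IH]; first by rewrite addn0 !subrr rnorm0 mul0r.
  rewrite addnS {1}/u big_ord_recr /= -/(u _) addrAC.
  rewrite (le_trans (rnormD _ _))// (le_trans (lerD IH (xn _)))//.
  rewrite ler_pdivlMr // mulrDl divfK ?gt_eqF // exprS; lra.
have du m n : (m <= n)%N -> rnorm (u n - u m) <= r ^+ m / (1 - r).
  move=> mn; rewrite -(subnKC mn) (le_trans (duk _ _))//.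
  by rewrite ler_pM2r ?invr_gt0 // lerBlDr lerDl exprn_ge0.
have [g ug] : exists g : AB, forall e : R, 0 < e -> exists n0, forall n,
    (n0 <= n)%N -> rnorm (u n - g) < e.
  apply: rnorm_complete => e e0.
  have [||n0 Hn0] := @expr_small R r (e * (1 - r)); [by rewrite r0|by rewrite mulr_gt0|].
  exists n0 => n m n0n n0m.
  wlog mn : n m n0n n0m / (m <= n)%N.
    by move=> H; case/orP: (leq_total m n) => ?; [|rewrite rdistC]; exact: H.
  by rewrite (le_lt_trans (du _ _ mn))// ltr_pdivrMr // Hn0.
have main e : 0 < e -> exists n, rnorm (x ^+ n) <= e /\ rnorm (u n - g) <= e.
  move=> e0; have [n1 Hn1] := ug _ e0.
  have [||n2 Hn2] := @expr_small R r e; [by rewrite r0|by []|].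
  exists (maxn n1 n2); rewrite (le_trans (xn _)) ?(ltW (Hn2 _ _)) ?leq_maxr //.
  by rewrite ltW // Hn1 // leq_maxl.
exists g.
  split; apply/eqP; rewrite -subr_eq0; apply/eqP;
    apply: (@rnorm_small0 _ _ _ _ (rnorm (1 - x) + 1)) => e /main[n [xe ue]].
  - rewrite (_ : _ - 1 = - ((1 - x) * (u n - g)) - x ^+ n); last first.
      by rewrite mulrBr xu !opprB addrA addrAC addrK.
    rewrite (le_trans (rnormB _ _))// [leRHS]mulrDl mul1r rnormN lerD //.
    by rewrite (le_trans (rnormM _ _))// ler_wpM2l.
  - rewrite (_ : _ - 1 = - ((u n - g) * (1 - x)) - x ^+ n); last first.
      by rewrite mulrBl ux !opprB addrA addrAC addrK.
    rewrite (le_trans (rnormB _ _))// [leRHS]mulrDl mul1r rnormN lerD //.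
    by rewrite (le_trans (rnormM _ _))// mulrC ler_wpM2l.
apply/ler_addgt0Pr => e /main[n [_ ue]].
rewrite (_ : g = (u n - u 0%N) - (u n - g)); last first.
  by rewrite {2}/u big_ord0 subr0 opprB addrC subrK.
rewrite (le_trans (rnormB _ _))// lerD //.
by rewrite (le_trans (du _ _ (leq0n n)))// expr0 mul1r.
Qed.

Lemma neumann_shift (c : Cplx R) x : rnorm x < Normc.normc c ->
  invertible (c%:A - x).
Proof.
move=> xc; have c0 : c != 0.
  by apply: contraTneq xc => ->; rewrite Normc.normc0 -leNgt.
have nc0 : 0 < Normc.normc c by exact: le_lt_trans (rnorm_ge0 x) xc.
rewrite (_ : c%:A - x = c *: (1 - c^-1 *: x)); last first.
  by rewrite scalerBr scalerA mulfV // scale1r.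
apply: invertibleZ => //.
have [||g Hg _] := @neumann (c^-1 *: x) (rnorm x / Normc.normc c).
- by rewrite rnormZ Normc.normcV mulrC.
- by rewrite ltr_pdivrMr // mul1r.
- by exists g.
Qed.

End Invertible.

(** * Elements with bounded powers *)

Lemma normc_le_ReIm {R : realType} (a b : R) :
  Normc.normc (Complex a b) <= `|a| + `|b|.
Proof.
rewrite -(@ler_pXn2r _ 2) ?nnegrE ?addr_ge0 ?sqrtr_ge0 //.
rewrite sqr_sqrtr ?addr_ge0 ?sqr_ge0 // sqrrD !real_normK ?num_real //.
by rewrite lerD2r lerDl mulrn_wge0 // mulr_ge0.
Qed.

Section PowerBounded.
Context {R : realType} {A : completeNormedModType (Cplx R)}.
Context {B : banach_algebra A}.
Local Notation AB := (balg R A B).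
Implicit Types x y g : AB.

(** Compactness turns local bounds into a uniform one. The compact set is a square containing the
    disc; the condition on the modulus sits inside [P], which therefore holds vacuously near points
    outside the disc. *)
Lemma resolvent_bounded x :
  (forall z : Cplx R, Normc.normc z <= 1 -> invertible (1 - z *: x)) ->
  exists2 M : R, 0 < M & forall z : Cplx R, Normc.normc z <= 1 ->
    exists2 g, inverses (1 - z *: x) g & rnorm g <= M.
Proof.
move=> xinv.
pose P (M : R) (p : R * R) := Normc.normc (Complex p.1 p.2) <= 1 ->
  exists2 g, inverses (1 - Complex p.1 p.2 *: x) g & rnorm g <= M.
have close (p q : R * R) (e : R) : ball p e q ->
    Normc.normc (Complex q.1 q.2 - Complex p.1 p.2) <= 2 * e.
  move=> [/= b1 b2]; rewrite (le_trans (normc_le_ReIm _ _))//.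
  move: b1 b2; rewrite -!ball_normE /ball_ /= => b1 b2.
  by rewrite mulr_natl mulr2n lerD // distrC ltW.
have /compact_near_coveringP/(_ R (pinfty_nbhs R) P) :
    compact (`[-1 : R, 1] `*` `[-1 : R, 1]).
  by apply: compact_setX; exact: segment_compact.
move=> /(_ _) [].
  move=> p _; have [p1|p1] := leP (Normc.normc (Complex p.1 p.2)) 1; last first.
    pose e := (Normc.normc (Complex p.1 p.2) - 1) / 4.
    have e0 : 0 < e by rewrite divr_gt0 // subr_gt0.
    exists (ball p e, setT); first by split; [exact: nbhsx_ballx|exact: filterT].
    move=> [q M] [/= /close pq _] q1; exfalso.
    have := normcB (Complex q.1 q.2) (Complex q.1 q.2 - Complex p.1 p.2).
    by rewrite subKr /e in pq q1 p1 *; lra.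
  have [g pg] := xinv _ p1.
  pose K := rnorm g * rnorm x + 1.
  have K0 : 0 < K by rewrite ltr_wpDl // mulr_ge0.
  have e0 : 0 < (4 * K)^-1 by rewrite invr_gt0 mulr_gt0.
  exists (ball p (4 * K)^-1, [set M | 2 * rnorm g <= M]).
    by split; [exact: nbhsx_ballx|exact: nbhs_pinfty_ge (num_real _)].
  move=> [q M] [/= /close pq gM] _; rewrite /P /=.
  set w := Complex q.1 q.2 - Complex p.1 p.2 in pq.
  (* With [p] and [q] read as complex numbers, 1 - q x = (1 - p x)(1 - w g x), and the radius of the
     ball puts the last factor within 1/2 of 1. *)
  have [||h Hh h2] := @neumann _ _ B (w *: (g * x)) 2^-1.
  - rewrite rnormZ (@le_trans _ _ (2 * (4 * K)^-1 * K)) //.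
      rewrite ler_pM // (le_trans (rnormM _ _))// /K lerDl //.
    by rewrite invfM mulrA mulfVK ?gt_eqF //; lra.
  - by lra.
  exists (h * g).
    rewrite (_ : 1 - _ = (1 - Complex p.1 p.2 *: x) * (1 - w *: (g * x))).
      exact: inversesM.
    rewrite mulrBr mulr1 -scalerAr mulrA pg.1 mul1r /w scalerBl.
    by rewrite opprB addrA subrK.
  rewrite (le_trans (rnormM _ _))// (le_trans _ gM)// ler_wpM2r //.
  by rewrite (le_trans h2) // (_ : 1 - 2^-1 = 2^-1 :> R) ?invrK //; lra.
move=> M0 [_ HM].
pose M := `|M0| + 1.
exists M; first by rewrite ltr_wpDl.
move=> z z1; have Mz : M0 < M by rewrite /M (le_lt_trans (ler_norm _)) // ltrDl.
have [] := HM _ Mz (complex.Re z, complex.Im z).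
- have [a1 b1] : `|complex.Re z| <= 1 /\ `|complex.Im z| <= 1.
    case: z z1 => a b /= ab1.
    have ab2 : a ^+ 2 + b ^+ 2 <= 1.
      rewrite -(sqr_sqrtr (addr_ge0 (sqr_ge0 a) (sqr_ge0 b))).
      by rewrite expr_le1 ?sqrtr_ge0.
    have := sqr_ge0 a; have := sqr_ge0 b => *.
    by split; rewrite -(@expr_le1 _ 2) // real_normK ?num_real //; lra.
  by split; rewrite /= in_itv /= -ler_norml.
- by case: (z) z1.
by move=> g gz gM; exists g => //; case: (z) gz.
Qed.

Lemma sqrtC_unit (w : Cplx R) : Normc.normc w = 1 ->
  exists2 v : Cplx R, v ^+ 2 = w & Normc.normc v = 1.
Proof.
move=> w1; exists (sqrtC w); first exact: sqrtCK.
have := normcX (sqrtC w) 2; rewrite sqrtCK w1 => /esym/eqP.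
by rewrite sqrp_eq1 ?normc_ge0 // => /eqP.
Qed.

(* Elementary form of the spectral radius formula.  Averaging the inverses of
   1 - v z and 1 + v z gives that of 1 - v^2 z^2, so the Lipschitz constant of
   the resolvent survives squaring; hence smallness of some power (r x)^(2^j)
   propagates from r = 0 to r = 1 in steps of fixed length. *)
Lemma power_bounded x :
  (forall z : Cplx R, Normc.normc z <= 1 -> invertible (1 - z *: x)) ->
  exists M : R, forall n, rnorm (x ^+ n) <= M.
Proof.
move=> /resolvent_bounded[M M0 HM].
pose L := rnorm x * M ^+ 2 + 1.
have L0 : 0 < L by rewrite ltr_wpDl // mulr_ge0 // exprn_ge0 // ltW.
have lip j : forall (w : Cplx R) (r s : R), Normc.normc w = 1 ->
    0 <= r <= 1 -> 0 <= s <= 1 ->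
    exists g h, [/\ inverses (1 - w *: (r%:C%C *: x) ^+ (2 ^ j)) g,
      inverses (1 - w *: (s%:C%C *: x) ^+ (2 ^ j)) h &
      rnorm (g - h) <= L * `|r - s|].
  elim: j => [|j IH] w r s w1 r01 s01.
    have bnd (t : R) : 0 <= t <= 1 -> Normc.normc (w * t%:C%C) <= 1.
      by move=> /andP[t0 t1]; rewrite Normc.normcM w1 mul1r normcr ger0_norm.
    have [g Hg gM] := HM _ (bnd _ r01).
    have [h Hh hM] := HM _ (bnd _ s01).
    exists g, h; rewrite !expr1 !scalerA; split => //.
    have -> : g - h = g * ((w * (r - s)%:C%C) *: x) * h.
      have -> : (w * (r - s)%:C%C) *: x =
          (1 - (w * s%:C%C) *: x) - (1 - (w * r%:C%C) *: x).
        by rewrite opprB [RHS]addrC addrA subrK rmorphB mulrBr scalerBl.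
      by rewrite mulrBr mulrBl Hg.2 mul1r -mulrA Hh.1 mulr1.
    rewrite (le_trans (rnormM _ _))// (@le_trans _ _
      (M * (`|r - s| * rnorm x) * M)) //.
      rewrite ler_pM // (le_trans (rnormM _ _))// ler_pM //.
      by rewrite rnormZ Normc.normcM w1 mul1r normcr.
    have := normr_ge0 (r - s); rewrite /L => rs0.
    by rewrite mulrDl mul1r; nra.
  have [v v2 v1] := sqrtC_unit _ w1.
  have [g1 [h1 [Hg1 Hh1 gh1]]] := IH v r s v1 r01 s01.
  have [|g2 [h2 [Hg2 Hh2 gh2]]] := IH (- v) r s _ r01 s01.
    by rewrite (normcN (v : Rcomplex R)).
  exists (2^-1 *: (g1 + g2)), (2^-1 *: (h1 + h2)).
  have avg (y g g' : AB) : inverses (1 - v *: y) g -> inverses (1 - (- v) *: y) g' ->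
      inverses (1 - w *: y ^+ 2) (2^-1 *: (g + g')).
    rewrite scaleNr opprK => Hg Hg'.
    have fac : 1 - w *: y ^+ 2 = (1 + v *: y) * (1 - v *: y).
      rewrite mulrBr mulr1 mulrDl mul1r opprD addrA addrK.
      by rewrite scaler_mulACA -[v * v]expr2 v2 -expr2.
    have fac' : 1 - w *: y ^+ 2 = (1 - v *: y) * (1 + v *: y).
      rewrite mulrDr mulr1 mulrBl mul1r addrA subrK.
      by rewrite scaler_mulACA -[v * v]expr2 v2 -expr2.
    have two : (2^-1 : Cplx R) *: ((1 + v *: y) + (1 - v *: y)) = 1.
      by rewrite addrACA subrr addr0 -mulr2n -[X in _ *: X]scaler_nat scalerA mulVf ?scale1r //.
    split.
      rewrite -scalerAr mulrDr {1}fac -mulrA Hg.1 mulr1 fac' -mulrA Hg'.1 mulr1.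
      exact: two.
    rewrite -scalerAl mulrDl {1}fac' mulrA Hg.2 mul1r fac mulrA Hg'.2 mul1r.
    exact: two.
  split; [by rewrite expnSr exprM; exact: avg|by rewrite expnSr exprM; exact: avg|].
  rewrite -scalerBr opprD addrACA.
  have -> : (2^-1 : Cplx R) = (2^-1 : R)%:C%C by rewrite fmorphV rmorph_nat.
  rewrite rnormZr ger0_norm ?invr_ge0 //.
  have := rnormD (g1 - h1) (g2 - h2); lra.
(* The threshold 1/9 reproduces itself: |z| <= 1/9 puts the inverse of 1 - z within 1/8 of 1, the
   Lipschitz move costs another 1/8, being within 1/4 of 1 forces |z'| <= 1/3, and squaring returns
   1/9. *)
pose small (r : R) := exists j, rnorm ((r%:C%C *: x) ^+ (2 ^ j)) <= 9^-1.
have step (r s : R) : 0 <= r <= 1 -> 0 <= s <= 1 -> L * `|r - s| <= 8^-1 ->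
    small r -> small s.
  move=> r01 s01 rs [j].
  have [g [h []]] := lip j 1 r s (Normc.normc1 _) r01 s01.
  rewrite !scale1r; set z := _ ^+ _; set z' := _ ^+ _ => Hg Hh gh z9.
  have bound (y k : AB) : inverses (1 - y) k -> k - 1 = y + (k - 1) * y.
    by move=> [_ H]; rewrite mulrBl mul1r [RHS]addrC subrK -[in LHS]H mulrBr mulr1 subKr.
  have g1 : rnorm (g - 1) <= 8^-1.
    have := rnormD z ((g - 1) * z); rewrite -bound // => H1.
    have := rnormM (g - 1) z; have := rnorm_ge0 (g - 1); have := rnorm_ge0 z.
    nra.
  have h1 : rnorm (h - 1) <= 4^-1.
    have -> : h - 1 = (g - 1) - (g - h) by rewrite opprB [RHS]addrC addrA subrK.
    have := rnormB (g - 1) (g - h); lra.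
  have z3 : rnorm z' <= 3^-1.
    have := rnormB (h - 1) ((h - 1) * z'); rewrite {1}(bound _ _ Hh) addrK => H1.
    have := rnormM (h - 1) z'; have := rnorm_ge0 (h - 1); have := rnorm_ge0 z'.
    nra.
  exists j.+1; rewrite expnSr exprM -/z' (le_trans (rnormX _ _))//.
  have := rnorm_ge0 z'; nra.
have d0 : 0 < (8 * L)^-1 by rewrite invr_gt0 mulr_gt0.
pose N := (Num.trunc (8 * L)).+1.
have NL : 8 * L < N%:R by exact: truncnS_gt.
have N0 : 0 < N%:R :> R by rewrite ltr0n.
have all_small i : (i <= N)%N -> small (i%:R / N%:R).
  elim: i => [_|i IH iN].
    exists 0%N; rewrite mul0r expr1 rmorph0 scale0r rnorm0.
    by rewrite invr_ge0.
  have in01 k : (k <= N)%N -> 0 <= (k%:R / N%:R : R) <= 1.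
    by move=> kN; rewrite divr_ge0 // ler_pdivrMr // mul1r ler_nat.
  apply: (step _ _ (in01 _ (ltnW iN)) (in01 _ iN) _ (IH (ltnW iN))).
  rewrite distrC -mulrBl -natr1 [i%:R + 1]addrC addrK mul1r.
  rewrite ger0_norm ?invr_ge0 //.
  by rewrite ler_pdivrMr //; lra.
have [j] := all_small N (leqnn N).
rewrite divff ?gt_eqF // scale1r => xj.
have q0 : (0 < 2 ^ j)%N by rewrite expn_gt0.
(* As |x^(2^j)| <= 1, only the remainder of [n] modulo [2 ^ j] matters. *)
exists (\sum_(i < 2 ^ j) rnorm (x ^+ i)) => n.
rewrite (divn_eq n (2 ^ j)) exprD mulnC exprM (le_trans (rnormM _ _))//.
rewrite (@le_trans _ _ (rnorm (x ^+ (n %% 2 ^ j)))) //.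
  rewrite ler_piMl // (le_trans (rnormX _ _))// exprn_ile1 //.
  by rewrite (le_trans xj) //; lra.
by rewrite (bigD1 (Ordinal (ltn_pmod n q0))) //= lerDl sumr_ge0.
Qed.

End PowerBounded.

(** * Square roots and Chebyshev polynomials *)

Section Halving.
Context {R : realType} {A : completeNormedModType (Cplx R)}.
Context {B : banach_algebra A}.
Local Notation AB := (balg R A B).
Implicit Types x y : AB.

(* With y = 1 - c(t) and Y = 1 - c(2t), the double angle formula reads
   y = Y / 4 + y^2 / 2.  The iterates W_i of this equation started at 0 stay in the
   ball of radius |Y| / 2 < 1, and y - W_i = y prod_(l < i) (y + W_l) / 2
   tends to 0 as soon as the powers of y are bounded. *)
Lemma rnorm_halving y (M : R) :
  (forall n, rnorm (y ^+ n) <= M) -> rnorm (y *+ 4 - y ^+ 2 *+ 2) < 2 ->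
  rnorm y <= rnorm (y *+ 4 - y ^+ 2 *+ 2) / 2.
Proof.
move=> yM; set Y := _ - _ => Y2; set g := rnorm Y / 2.
have g0 : 0 <= g by rewrite divr_ge0.
have g1 : g < 1 by rewrite /g; lra.
(* Polynomials commute, so [ring] applies to them; the identities are then evaluated at [y] through
   [ev]. *)
pose c : {poly Cplx R} := (2^-1)%:P.
pose Z : {poly Cplx R} := 'X *+ 4 - 'X ^+ 2 *+ 2.
pose W i := iter i (fun w => c ^+ 2 * Z + c * w ^+ 2) 0.
pose F := fix F i := if i is j.+1 then c * (F j * ('X + W j)) else 1.
pose ev : {rmorphism {poly Cplx R} -> AB} := horner_alg (y : AB).
have evX : ev 'X = y by exact: horner_algX.
have evZ : ev Z = Y by rewrite /Z rmorphB !rmorphMn rmorphXn /= evX.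
have halfE : (2^-1 : Cplx R) = (2^-1 : R)%:C%C by rewrite fmorphV rmorph_nat.
have evc p : rnorm (ev (c * p)) = rnorm (ev p) / 2.
  rewrite rmorphM [ev c]horner_algC mulr_algl.
  by rewrite halfE rnormZr ger0_norm ?invr_ge0 // mulrC.
have evW i : rnorm (ev (W i)) <= g.
  elim: i => [|i IH]; first by rewrite /W /= rmorph0 rnorm0.
  rewrite /W /= -/(W i) rmorphD (le_trans (rnormD _ _))//.
  rewrite expr2 -mulrA !evc evZ rmorphXn.
  have := rnormX (ev (W i)) 2; have := rnorm_ge0 (ev (W i)).
  rewrite /g in g0 g1 IH *; nra.
have XW i : 'X - W i = 'X * F i.
  elim: i => [|i IH]; first by rewrite /W /= subr0 mulr1.
  have c2 : c * 2%:R = 1.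
    by rewrite /c -polyC_natr -polyCM mulVf ?pnatr_eq0.
  have -> : 'X * F i.+1 = c * (('X - W i) * ('X + W i)) by rewrite IH /=; ring.
  rewrite /W /= -/(W i) /Z.
  have -> : 'X - (c ^+ 2 * ('X *+ 4 - 'X ^+ 2 *+ 2) + c * W i ^+ 2) =
    c * (('X - W i) * ('X + W i)) + (1 - (c * 2%:R) ^+ 2) * 'X +
    (c * 2%:R - 1) * c * 'X ^+ 2 by ring.
  by rewrite c2 expr1n !subrr !mul0r !addr0.
(* In each factor (y + W_l) / 2, multiplying by y only raises a power that [M] bounds, and
   multiplying by W_l costs [g]; hence the rate (1 + g) / 2 < 1. *)
pose q := (1 + g) / 2.
have q01 : 0 <= q < 1 by rewrite /q; apply/andP; split; lra.
have bnd i j : rnorm (ev ('X ^+ j * F i)) <= M * q ^+ i.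
  elim: i j => [|i IH] j; first by rewrite /= !mulr1 rmorphXn /= evX.
  rewrite /= (_ : 'X ^+ j * _ = c * ('X ^+ j.+1 * F i) + c * (('X ^+ j * F i) * W i)).
    rewrite rmorphD (le_trans (rnormD _ _))// !evc.
    have pW : rnorm (ev ('X ^+ j * F i * W i)) <= (M * q ^+ i) * g.
      by rewrite rmorphM (le_trans (rnormM _ _))// ler_pM.
    have -> : M * q ^+ i.+1 = M * q ^+ i / 2 + M * q ^+ i * g / 2.
      by rewrite exprSr {2}/q; field.
    by rewrite lerD // ler_pM2r ?invr_gt0.
  by rewrite exprS; move: ('X ^+ j) (F i) (W i) => a b d; ring.
rewrite -/g; apply/ler_addgt0Pr => e e0.
have [] := @expr_small _ q (e / (`|M| + 1)) q01.
  by rewrite divr_gt0 // ltr_wpDl.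
move=> i /(_ _ (leqnn i)) qe.
have yW : y - ev (W i) = ev ('X ^+ 1 * F i) by rewrite expr1 -XW rmorphB /= evX.
rewrite -(subrK (ev (W i)) y) (le_trans (rnormD _ _))// addrC lerD //.
rewrite yW (le_trans (bnd _ _))//.
have qi : 0 <= q ^+ i by rewrite exprn_ge0 //; case/andP: q01.
rewrite (@le_trans _ _ ((`|M| + 1) * q ^+ i)) //.
  by rewrite ler_wpM2r // (le_trans (ler_norm _))// lerDl.
by rewrite mulrC -ler_pdivlMr ?ltW // ltr_wpDl.
Qed.

End Halving.

Fixpoint cheb (K : comNzRingType) n : {poly K} :=
  if n is n'.+1 then
    if n' is n''.+1 then 'X * cheb K n' *+ 2 - cheb K n'' else 'X
  else 1.

Lemma chebSS (K : comNzRingType) n :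
  cheb K n.+2 = 'X * cheb K n.+1 *+ 2 - cheb K n.
Proof. by []. Qed.

Lemma cos_mulSS {R : realType} (x : R) (n : nat) :
  cos (n.+2%:R * x) = cos x * cos (n.+1%:R * x) *+ 2 - cos (n%:R * x).
Proof.
have -> : n.+2%:R * x = n.+1%:R * x + x by rewrite -natr1 mulrDl mul1r.
have -> : n%:R * x = n.+1%:R * x - x by rewrite -natr1 mulrDl mul1r addrK.
by rewrite cosD cosB; ring.
Qed.

Lemma cheb_cos {R : realType} (x : R) (n : nat) :
  (cheb (Cplx R) n).[(cos x)%:C%C] = (cos (n%:R * x))%:C%C.
Proof.
suff [] : (cheb (Cplx R) n).[(cos x)%:C%C] = (cos (n%:R * x))%:C%C /\
  (cheb (Cplx R) n.+1).[(cos x)%:C%C] = (cos (n.+1%:R * x))%:C%C by [].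
elim: n => [|n [IH1 IH2]].
  by rewrite /= mul0r cos0 mul1r hornerC hornerX.
split=> //; rewrite chebSS hornerD hornerN hornerMn hornerM hornerX IH1 IH2.
by rewrite cos_mulSS rmorphB rmorphMn rmorphM.
Qed.

Lemma cheb_joukowski (K : fieldType) (z : K) (n : nat) : z != 0 -> (2 : K) != 0 ->
  (cheb K n).[(z + z^-1) / 2] = (z ^+ n + z^-1 ^+ n) / 2.
Proof.
move=> z0 n2; suff [] : (cheb K n).[(z + z^-1) / 2] = (z ^+ n + z^-1 ^+ n) / 2 /\
  (cheb K n.+1).[(z + z^-1) / 2] = (z ^+ n.+1 + z^-1 ^+ n.+1) / 2 by [].
elim: n => [|n [IH1 IH2]].
  by rewrite /= !expr0 !expr1 hornerC hornerX divff.
split=> //; rewrite chebSS hornerD hornerN hornerMn hornerM hornerX IH1 IH2.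
rewrite !exprS; set a := z ^+ n; set b := z^-1 ^+ n.
by field; rewrite n2.
Qed.

(** Write k = (z + 1/z) / 2. If |z| = 1 then k is the real part of z, a cosine; otherwise z or 1/z
    has modulus above 1, and its powers make (z^n + z^-n) / 2 unbounded. *)
Lemma cheb_unbounded {R : realType} (k : Cplx R) :
  (exists x : R, k = (cos x)%:C%C) \/
  forall K : R, exists n, K < Normc.normc (1 - (cheb (Cplx R) n).[k]).
Proof.
have n2 : (2 : Cplx R) != 0 by rewrite pnatr_eq0.
pose s := sqrtC (k ^+ 2 - 1); pose z := k + s.
have zz : z * (k - s) = 1 by rewrite /z mulrC -subr_sqr sqrtCK subKr.
have z0 : z != 0 by apply/eqP => z0; move: zz; rewrite z0 mul0r => /esym/eqP; rewrite oner_eq0.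
have zV : z^-1 = k - s by rewrite -[RHS]mul1r -(mulVf z0) -mulrA zz mulr1.
have kE : k = (z + z^-1) / 2.
  by rewrite zV /z addrACA subrr addr0 -mulr2n -(mulr_natr k) mulfK.
have big (w : Cplx R) : w != 0 -> k = (w + w^-1) / 2 -> 1 < Normc.normc w ->
    forall K : R, exists n, K < Normc.normc (1 - (cheb (Cplx R) n).[k]).
  move=> w0 kw w1 K; pose r := (Normc.normc w)^-1.
  have w0' : 0 < Normc.normc w by exact: lt_trans w1.
  have r01 : 0 <= r < 1 by rewrite /r invr_ge0 normc_ge0 invf_lt1.
  have K4 : 0 < 2 * `|K| + 4 by rewrite ltr_wpDl // mulr_ge0.
  have [|] := @expr_small _ r (2 * `|K| + 4)^-1 r01; first by rewrite invr_gt0.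
  move=> n /(_ _ (leqnn n)); rewrite exprVn ltf_pV2 ?posrE ?exprn_gt0 //.
  move=> Kw; exists n; rewrite kw cheb_joukowski //.
  have E : w ^+ n = 2 * (1 - (1 - (w ^+ n + w^-1 ^+ n) / 2)) - w^-1 ^+ n.
    by rewrite subKr mulrC divfK // addrK.
  set u := Normc.normc (1 - _).
  have : Normc.normc (w ^+ n) <= 2 * (1 + u) + 1.
    rewrite {1}E (le_trans (normcB _ _))// lerD //.
      rewrite Normc.normcM (_ : Normc.normc 2 = 2); last first.
        by rewrite -[2 : Cplx R](rmorph_nat (real_complex R)) normcr ger0_norm.
      by rewrite ler_wpM2l // (le_trans (normcB _ _))// Normc.normc1.
    rewrite normcX Normc.normcV exprn_ile1 ?invr_ge0 //.
    by rewrite invf_le1 // ltW.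
  have := ler_norm K; rewrite normcX; lra.
have [z1|z1|z1] := ltgtP 1 (Normc.normc z).
- by right; exact: (big z).
- right; apply: (big z^-1); rewrite ?invr_eq0 // ?invrK 1?addrC //.
  rewrite Normc.normcV invf_gt1 // lt_neqAle normc_ge0 andbT eq_sym.
  by apply: contra_neq z0; exact: Normc.eq0_normc.
left; case: z z0 zz zV kE z1 {big} => a b z0 zz zV kE z1.
have ab : a ^+ 2 + b ^+ 2 = 1.
  by rewrite -(sqr_sqrtr (addr_ge0 (sqr_ge0 a) (sqr_ge0 b))) -[Num.sqrt _]z1 expr1n.
have a1 : -1 <= a <= 1.
  by rewrite -ler_norml -(@expr_le1 _ 2) // real_normK ?num_real // -ab lerDl sqr_ge0.
exists (acos a); rewrite acosK ?in_itv //= kE.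
have -> : (Complex a b)^-1 = Complex a (- b).
  by rewrite -[LHS]/(Complex _ _) ab !divr1.
rewrite -[_ + _]/(Complex (a + a) (b - b)) subrr.
rewrite -[Complex _ 0]/((a + a)%:C%C) (_ : a + a = a * 2%:R); last by ring.
by rewrite rmorphM rmorph_nat mulfK.
Qed.

(** * Invertibility of polynomials in a cosine function *)

Section Cosine.
Context {R : realType} {A : completeNormedModType (Cplx R)}.
Context {B : banach_algebra A}.
Local Notation AB := (balg R A B).

Lemma balg_mulr2n_inj (x y : AB) : x *+ 2 = y *+ 2 -> x = y.
Proof.
have n2 : (2%:R : Cplx R) != 0 by rewrite pnatr_eq0.
by rewrite -[x *+ 2]scaler_nat -[y *+ 2]scaler_nat => /(scalerI n2).
Qed.

Variable C : R -> AB.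
Hypothesis C0 : C 0 = 1.
Hypothesis CD : forall s t, C (s + t) + C (s - t) = (C s * C t) *+ 2.

Lemma cosine_even t : C (- t) = C t.
Proof.
have := CD 0 t; rewrite C0 mul1r add0r sub0r mulr2n => /addrI //.
Qed.

Lemma cosine_comm s t : C s * C t = C t * C s.
Proof.
by apply: balg_mulr2n_inj; rewrite -!CD addrC [t + s]addrC -(cosine_even (s - t)) opprB addrC.
Qed.

Lemma cosine_SS s n :
  C (n.+2%:R * s) = C s * C (n.+1%:R * s) *+ 2 - C (n%:R * s).
Proof.
rewrite cosine_comm -CD -(natr1 n.+1) mulrDl mul1r.
by rewrite -{3}(natr1 n) mulrDl mul1r !addrK.
Qed.

Lemma cosine_cheb s n : horner_alg (C s) (cheb _ n) = C (n%:R * s).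
Proof.
suff [] : horner_alg (C s) (cheb _ n) = C (n%:R * s) /\
  horner_alg (C s) (cheb _ n.+1) = C (n.+1%:R * s) by [].
elim: n => [|n [IH1 IH2]].
  by rewrite /= mul0r mul1r C0 rmorph1 horner_algX.
split=> //; rewrite chebSS rmorphB rmorphMn rmorphM /= IH1 IH2 horner_algX.
by rewrite cosine_SS.
Qed.

Lemma cosine_double t : 1 - C (2 * t) = (1 - C t) *+ 4 - (1 - C t) ^+ 2 *+ 2.
Proof.
pose q : {poly Cplx R} := (1 - 'X) *+ 4 - (1 - 'X) ^+ 2 *+ 2.
have -> : (1 - C t) *+ 4 - (1 - C t) ^+ 2 *+ 2 = horner_alg (C t) q.
  by rewrite rmorphB !rmorphMn rmorphXn rmorphB rmorph1 /= horner_algX.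
rewrite (_ : q = 1 - cheb _ 2); last by rewrite /q /=; ring.
by rewrite rmorphB rmorph1 -(cosine_cheb t 2).
Qed.

(** [C s - k%:A] is a factor of T_n(C s) - T_n(k) = (1 - mu) - (1 - C (n s)), which is invertible by
    the Neumann series; commuting factors of an invertible element are invertible. *)
Lemma cosine_sub_invertible s (k : Cplx R) n :
  rnorm (1 - C (n%:R * s)) < Normc.normc (1 - (cheb _ n).[k]) ->
  invertible (C s - k%:A).
Proof.
set mu := _.[k] => small.
have /factor_theorem[q pq] : root (cheb _ n - mu%:P) k.
  by rewrite /root hornerD hornerN hornerC subrr.
have E : horner_alg (C s) (cheb _ n - mu%:P) = (C s - k%:A) * horner_alg (C s) q.
  by rewrite pq mulrC rmorphM rmorphB /= horner_algX horner_algC.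
apply: (@invertible_commM _ _ _ _ (horner_alg (C s) q)).
  by rewrite -E pq rmorphM rmorphB /= horner_algX horner_algC.
rewrite -E rmorphB /= cosine_cheb horner_algC.
rewrite (_ : _ - _ = (1 - mu)%:A - (1 - C (n%:R * s))).
  exact: neumann_shift.
by rewrite scalerBl scale1r opprB [RHS]addrC addrA subrK.
Qed.

(** Over the complex numbers [p] splits into linear factors, each invertible at [x]. *)
Lemma horner_alg_invertible (x : AB) (p : {poly Cplx R}) : p != 0 ->
  (forall k, root p k -> invertible (x - k%:A)) -> invertible (horner_alg x p).
Proof.
move=> p0; have [r pE] := closed_field_poly_normal p => H.
have {}H k : k \in r -> invertible (x - k%:A).
  move=> kr; apply: H; rewrite pE rootZ ?lead_coef_eq0 //.
  by rewrite root_prod_XsubC.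
rewrite pE linearZ /= mulr_algl; apply: invertibleZ; first by rewrite lead_coef_eq0.
elim: r H {pE} => [|k r IH] H.
  by rewrite big_nil rmorph1; exists 1; split; rewrite mulr1.
rewrite big_cons rmorphM; apply: invertibleM.
  by rewrite rmorphB /= horner_algX horner_algC; apply: H; rewrite inE eqxx.
by apply: IH => k' kr; apply: H; rewrite inE kr orbT.
Qed.

Variable K : R.
Hypothesis CK : forall t, rnorm (1 - C t) <= K.

(** Contrapositively, an angle whose multiples up to [n0] all keep 1 - cos at most [m] satisfies cos
    (k x) > 0, that is 1 - cos (k x) < 1. The bound [n0] is uniform in [x]. *)
Definition escapes (m : R) (k n0 : nat) := forall x : R, cos (k%:R * x) <= 0 ->
  exists2 n, (n <= n0)%N & m < 1 - cos (n%:R * x).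

(** [power_bounded] asks that C (k s) - l = T_k(C s) - l be invertible when |1 - l| >= 1, so each
    root w of T_k - l is tested. If w is not a cosine, T_n(w) outgrows the bound [K]; if w = cos x,
    then cos (k x) = l forces cos (k x) <= 0 and [esc] provides [n]. *)
Lemma cosine_power_bounded (m : R) k n0 s : escapes m k n0 ->
  (forall n, (n <= n0)%N -> rnorm (1 - C (n%:R * s)) <= m) ->
  exists M : R, forall i, rnorm ((1 - C (k%:R * s)) ^+ i) <= M.
Proof.
move=> esc sm; apply: power_bounded => z z1.
have [->|z0] := eqVneq z 0.
  by rewrite scale0r subr0; exists 1; split; rewrite mulr1.
pose l := 1 - z^-1.
have -> : 1 - z *: (1 - C (k%:R * s)) = z *: (C (k%:R * s) - l%:A).
  rewrite /l !scalerBr scalerBl scalerBr scale1r scalerA mulfV // scale1r.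
  by rewrite !opprB addrCA.
apply: invertibleZ => //.
have l1 : 1 <= Normc.normc (1 - l).
  rewrite /l subKr Normc.normcV invf_ge1 // lt_neqAle normc_ge0 andbT eq_sym.
  by apply: contra_neq z0; exact: Normc.eq0_normc.
have -> : C (k%:R * s) - l%:A = horner_alg (C s) (cheb _ k - l%:P).
  by rewrite rmorphB /= cosine_cheb horner_algC.
apply: horner_alg_invertible.
  (* The polynomial is nonzero because its value at 1 is 1 - l, and |1 - l| >= 1. *)
  apply/eqP => /(congr1 (fun p => p.[(cos 0)%:C%C])); rewrite horner0.
  rewrite hornerD hornerN hornerC cheb_cos mulr0 cos0 => /eqP.
  rewrite subr_eq0 => /eqP l0; move: l1.
  by rewrite -l0 subrr Normc.normc0 ler10.
move=> w; rewrite /root hornerD hornerN hornerC subr_eq0 => /eqP wl.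
have [[x wx]|/(_ K)[n Kn]] := cheb_unbounded w; last first.
  by apply: (@cosine_sub_invertible _ _ n); exact: le_lt_trans (CK _) Kn.
have kx : cos (k%:R * x) <= 0.
  move: l1; rewrite -wl wx cheb_cos -(rmorph1 (real_complex R)) -rmorphB normcr.
  have := cos_le1 (k%:R * x) => c1; rewrite ger0_norm; lra.
have [n n0n mn] := esc _ kx.
apply: (@cosine_sub_invertible _ _ n); rewrite wx cheb_cos.
rewrite -(rmorph1 (real_complex R)) -rmorphB normcr.
by rewrite (le_lt_trans (sm _ n0n))// (lt_le_trans mn)// ler_norm.
Qed.

(** The index 2 k is among those controlled up to [n0], which gives the bound below 2 on 1 - C (2 k
    s) required by [rnorm_halving]. *)
Lemma cosine_halving (m : R) k n0 s : m < 2 -> escapes m k n0 -> (2 * k <= n0)%N ->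
  (forall n, (n <= n0)%N -> rnorm (1 - C (n%:R * s)) <= m) ->
  rnorm (1 - C (k%:R * s)) <= rnorm (1 - C ((2 * k)%:R * s)) / 2.
Proof.
move=> m2 esc kn sm.
have [M HM] := cosine_power_bounded _ _ _ _ esc sm.
have D : (1 - C (k%:R * s)) *+ 4 - (1 - C (k%:R * s)) ^+ 2 *+ 2 =
    1 - C ((2 * k)%:R * s) by rewrite -cosine_double natrM mulrA.
by rewrite -D; apply: rnorm_halving HM _; rewrite D (le_lt_trans (sm _ kn)).
Qed.

End Cosine.

(** * Multiples of an angle *)

Lemma cosDz {R : realType} (x : R) (p : int) : cos (x + p%:~R * (pi *+ 2)) = cos x.
Proof.
have H n (y : R) : cos (y + n%:R * (pi *+ 2)) = cos y.
  by rewrite mulr_natl periodicn //; exact: cosD2pi.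
case: p => n; first by rewrite -pmulrn H.
by rewrite NegzE mulrNz mulNr -pmulrn -[LHS](H n.+1) subrK.
Qed.

Lemma cosDn {R : realType} (x : R) (n : nat) : cos (x + n%:R * (pi *+ 2)) = cos x.
Proof. exact: (cosDz x n). Qed.

(** Pigeonhole: two of the Q + 1 fractional parts of 0, y, ..., Q y share one of [Q] boxes of length
    1/Q, and [q] is the difference of their indices. *)
Lemma dirichlet {R : realType} (y : R) (Q : nat) : (0 < Q)%N ->
  exists q (p : int), (0 < q <= Q)%N /\ `|q%:R * y - p%:~R| <= Q%:R^-1.
Proof.
move=> Q0; have Q0' : 0 < Q%:R :> R by rewrite ltr0n.
pose v (i : nat) : R := i%:R * y - (Num.floor (i%:R * y))%:~R.
have v01 i : 0 <= v i < 1.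
  have /andP[f1 f2] := floor_itv (i%:R * y).
  by rewrite /v subr_ge0 f1 /= ltrBlDl; move: f2; rewrite intrD.
have vQ i : (Num.trunc (Q%:R * v i) < Q)%N.
  have /andP[v0 v1] := v01 i.
  by rewrite truncn_lt_nat ?mulr_ge0 // gtr_pMr.
pose f (i : 'I_Q.+1) : 'I_Q := Ordinal (vQ i).
have : ~~ injectiveb f.
  apply/injectiveP => /leq_card; rewrite !card_ord; by rewrite ltnn.
case/injectivePn => i [j ij fij].
wlog lij : i j ij fij / (i < j)%N.
  move=> H; case: (ltngtP i j) => lij; first exact: (H i j).
    by apply: (H j i) => //; rewrite eq_sym.
  by move: ij; rewrite (val_inj lij) eqxx.
exists (j - i)%N, (Num.floor (j%:R * y) - Num.floor (i%:R * y)).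
split; first by rewrite subn_gt0 lij /= (leq_trans (leq_subr _ _)) // -ltnS.
have -> : (j - i)%N%:R * y - (Num.floor (j%:R * y) - Num.floor (i%:R * y))%:~R
    = v j - v i.
  by rewrite natrB ?(ltnW lij) // rmorphB /v /=; ring.
have tr k : (f k)%:R <= Q%:R * v k < (f k).+1%:R.
  by apply: truncn_itv; rewrite mulr_ge0 //; case/andP: (v01 k).
have := tr i; have := tr j; rewrite fij -natr1 => /andP[j1 j2] /andP[i1 i2].
rewrite -[leRHS]mul1r ler_pdivlMr // mulrC -{1}(ger0_norm (ltW Q0')) -normrM mulrBr.
rewrite ler_norml; lra.
Qed.

(** Steps no longer than the window cannot jump over it. *)
Lemma step_window {R : realType} (a s lo hi : R) : 0 < s -> s <= hi - lo -> a <= hi ->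
  exists j : nat, lo <= a + j%:R * s <= hi.
Proof.
move=> s0 sw ahi; have [loa|alo] := leP lo a.
  by exists 0%N; rewrite mul0r addr0 loa.
have d0 : 0 <= (lo - a) / s by rewrite divr_ge0 ?subr_ge0 // ltW.
exists (Num.trunc ((lo - a) / s)).+1.
have /andP[] := truncn_itv d0; rewrite -natr1.
rewrite ler_pdivlMr // ltr_pdivrMr //; set n := _%:R => t1 t2.
by rewrite mulrDl mul1r in t2 *; apply/andP; split; lra.
Qed.

Lemma cos_eq_abs {R : realType} (n : nat) (x : R) : cos (n%:R * `|x|) = cos (n%:R * x).
Proof. by rewrite -(cos_norm (n%:R * x)) normrM ger0_norm. Qed.

(* By Dirichlet some q <= Q brings q x within 2 h of 2 pi Z.  Unless q x is in 2 pi Z,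
   which cos(Q! x) <= 0 excludes, multiples of q x then come within h of pi. *)
Lemma escapes_exists {R : realType} (m : R) : m < 2 ->
  exists k n0, [/\ (0 < k)%N, (2 * k <= n0)%N & escapes m k n0].
Proof.
move=> m2; have pi0 := pi_gt0 R; have pi2 := pi_ge2 R.
have [h [h0 h1 Hh]] : exists h : R, [/\ 0 < h, h <= 1 &
    forall d, `|d| <= h -> m - 1 < cos d].
  have /cvgrPdist_lt/(_ (2 - m)) := @continuous_cos R 0.
  rewrite subr_gt0 => /(_ m2)/nbhs_ballP[e /= e0 He].
  exists (Num.min (e / 2) 1); split.
  - by rewrite lt_min ltr01 divr_gt0.
  - by rewrite ge_min lexx orbT.
  move=> d; rewrite le_min => /andP[de _].
  have de' : `|0 - d| < e by rewrite sub0r normrN (le_lt_trans de) //; lra.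
  by have := He d de'; rewrite /= cos0 ltr_norml; lra.
(* [Q] exceeds pi / h, so that 2 pi / Q <= 2 h; the factorial makes [k] a multiple of every possible
   [q]. *)
pose Q := (Num.trunc (pi / h)).+1; pose k := Q`!.
have Q0 : 0 < Q%:R :> R by rewrite ltr0n.
have QB : pi *+ 2 / Q%:R <= 2 * h.
  rewrite ler_pdivrMr // mulr2n.
  have : pi / h < Q%:R by exact: truncnS_gt.
  rewrite ltr_pdivrMr //; lra.
have k0 : (0 < k)%N by exact: fact_gt0.
exists k, (4 * k * Q)%N; split => //.
  by rewrite -mulnA -[(4 * _)%N]/((2 * 2) * _)%N -mulnA leq_pmul2l // mulnCA leq_pmulr // muln_gt0.
move=> x kx.
have [q [p [/andP[q0 qQ]]]] := dirichlet (x / (pi *+ 2)) Q isT.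
set al := q%:R * x - p%:~R * (pi *+ 2).
have pi20 : 0 < pi *+ 2 :> R by rewrite mulrn_wgt0.
move=> qp; have al2 : `|al| <= 2 * h.
  rewrite (le_trans _ QB) // -[pi *+ 2 / _]mulrC -ler_pdivrMr //.
  rewrite -[X in _ / X](ger0_norm (ltW pi20)).
  rewrite -normf_div (le_trans _ qp) // /al mulrBl mulrA mulfK ?gt_eqF //.
have cosq (j : nat) : cos ((j * q)%:R * x) = cos (j%:R * `|al|).
  rewrite cos_eq_abs -[RHS](cosDz _ (j%:Z * p)); congr cos.
  by rewrite /al intrM natrM -pmulrn; ring.
have qk : (q %| k)%N by rewrite dvdn_fact // q0.
have al1 : pi / 2 <= (k %/ q)%:R * `|al|.
  rewrite leNgt; apply/negP => kal; move: kx.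
  rewrite -(divnK qk) cosq leNgt cos_gt0_pihalf // kal andbT.
  by rewrite (@lt_le_trans _ _ 0) ?mulr_ge0 // oppr_lt0 divr_gt0.
have al0 : 0 < `|al|.
  rewrite lt_neqAle normr_ge0 andbT eq_sym; apply/eqP => al0.
  by move: al1; rewrite al0 mulr0; lra.
have [||j /andP[j1 j2]] := @step_window _ 0 `|al| (pi - h) (pi + h) al0.
- by lra.
- by lra.
(* From j |al| <= pi + h <= 2 pi <= 4 k |al| follows j <= 4 k, hence j q <= 4 k Q. *)
exists (j * q)%N.
  apply: leq_mul qQ; rewrite -(ler_nat R).
  rewrite -(ler_pM2r al0) (@le_trans _ _ (pi * 2)) //; first by lra.
  have : (k %/ q)%:R * `|al| <= k%:R * `|al|.
    by rewrite ler_pM2r // ler_nat leq_div.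
  rewrite natrM; lra.
rewrite cosq -[j%:R * _](subrK pi) cosDpi opprK.
have dh : `|j%:R * `|al| - pi| <= h by rewrite ler_norml; apply/andP; split; lra.
have := Hh _ dh; lra.
Qed.

(** With [d = x - pi], cos (2 d) >= 0 makes the square of cos d at least 1/2, and 7/10 lies below 1
    / sqrt 2. It is still large enough for 1 + 7/10 to exceed 8 / (3 sqrt 3). *)
Lemma cos_near_pi {R : realType} (x : R) : pi * (3 / 4) <= x <= pi * (5 / 4) ->
  cos x <= - (7 / 10).
Proof.
move=> /andP[x1 x2]; have pi0 := pi_gt0 R.
rewrite -(subrK pi x) cosDpi lerN2; set d := x - pi.
have d1 : - (pi / 2) <= d <= pi / 2 by rewrite /d; apply/andP; split; lra.
have d2 : - (pi / 2) <= d *+ 2 <= pi / 2.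
  by rewrite -[d *+ 2]mulr_natr /d; apply/andP; split; lra.
have c1 := cos_ge0_pihalf d1; have c2 := cos_ge0_pihalf d2.
rewrite cos_mulr2n in c2; nra.
Qed.

(* At t = n pi / b the distance is 1 - cos(n be) with be = pi (b - a) / b, and some
   n be comes within pi / 4 of pi mod 2 pi unless be = 2 pi / 3, that is b = 3 a;
   in that case cos u - cos 3u = 4 cos u (1 - cos^2 u), maximal at cos u = 1 / sqrt 3. *)
Lemma cos_sup_dist {R : realType} (a b : R) : 0 <= a -> 0 <= b -> a != b ->
  exists t : R, 8 / (3 * Num.sqrt 3) <= `|cos (t * a) - cos (t * b)|.
Proof.
wlog ab : a b / a < b.
  move=> H a0 b0 ab; case: (ltgtP a b) => lab; first exact: H.
    have [|t Ht] := H b a lab b0 a0; first by rewrite eq_sym.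
    by exists t; rewrite distrC.
  by move: ab; rewrite lab eqxx.
move=> a0 _ _; have b0 : 0 < b by exact: le_lt_trans ab.
have pi0 := pi_gt0 R.
have s30 : 0 < Num.sqrt 3 :> R by rewrite sqrtr_gt0.
have s3 : Num.sqrt 3 ^+ 2 = 3 :> R by rewrite sqr_sqrtr.
pose be := pi * (b - a) / b.
have beb : be * b = pi * (b - a) by rewrite /be divfK ?gt_eqF.
have be0 : 0 < be by rewrite /be divr_gt0 ?mulr_gt0 ?subr_gt0.
have be1 : be <= pi by rewrite -(ler_pM2r b0) beb ler_pM2l // lerBlDr lerDl.
have hit n : cos (n%:R * be) <= - (7 / 10) ->
    exists t : R, 8 / (3 * Num.sqrt 3) <= `|cos (t * a) - cos (t * b)|.
  move=> cn; exists (n%:R * pi / b).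
  have -> : n%:R * pi / b * b = n%:R * pi by rewrite divfK ?gt_eqF.
  have -> : n%:R * pi / b * a = n%:R * pi - n%:R * be.
    by rewrite /be; field; rewrite gt_eqF.
  have sn : sin (n%:R * pi) = 0 :> R.
    by rewrite mulr_natl -[_ *+ n]add0r (alternatingn (@sinDpi R)) sin0 mulr0.
  have c2 : `|cos (n%:R * pi)| = 1 :> R by exact: sin0cos1.
  rewrite cosB sn mul0r addr0 -[X in _ - X]mulr1 -mulrBr normrM c2 mul1r.
  rewrite ler0_norm; last by have := cos_le1 (n%:R * be); lra.
  rewrite ler_pdivrMr ?mulr_gt0 //; nra.
have [b1|b1] := leP be (pi / 2).
  have [||j Hj] := @step_window _ 0 be (pi * (3 / 4)) (pi * (5 / 4)) be0; [lra|lra|].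
  by apply: (hit j); apply: cos_near_pi; rewrite -[_ * be]add0r.
have [b2|b2] := leP (pi * (3 / 4)) be.
  by apply: (hit 1%N); apply: cos_near_pi; rewrite mul1r; apply/andP; split; lra.
(* Here [be] lies between pi / 2 and 3 pi / 4. Its multiples by 3 j + 1 or 3 j + 2 move, modulo 2
   pi, in steps of |3 be - 2 pi|, which is at most the window length pi / 2 and vanishes only at be
   = 2 pi / 3. *)
have [e0|e0|e0] := ltgtP (be * 3) (pi * 2).
- have [|||j Hj] := @step_window _ (- (be * 2)) (pi * 2 - be * 3)
    (- (pi * (5 / 4))) (- (pi * (3 / 4))); [lra|lra|lra|].
  apply: (hit (3 * j + 2)%N).
  have -> : (3 * j + 2)%:R * be =
      - (- (be * 2) + j%:R * (pi * 2 - be * 3)) + j%:R * (pi *+ 2).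
    by rewrite natrD natrM; ring.
  by rewrite cosDn; apply: cos_near_pi; lra.
- have [|||j Hj] := @step_window _ be (be * 3 - pi * 2)
    (pi * (3 / 4)) (pi * (5 / 4)); [lra|lra|lra|].
  apply: (hit (3 * j + 1)%N).
  have -> : (3 * j + 1)%:R * be =
      (be + j%:R * (be * 3 - pi * 2)) + j%:R * (pi *+ 2).
    by rewrite natrD natrM; ring.
  by rewrite cosDn; apply: cos_near_pi.
have ba : b = a * 3.
  apply: (mulfI (lt0r_neq0 pi0)).
  have : be * 3 * b = pi * (b - a) * 3 by rewrite -beb; ring.
  rewrite e0; lra.
pose c : R := (Num.sqrt 3)^-1; pose u := acos c.
have c0 : 0 < c by rewrite invr_gt0.
have c3 : c ^+ 2 * 3 = 1 by rewrite /c exprVn s3 mulVf.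
have cu : cos u = c.
  rewrite /u acosK // in_itv /=; apply/andP; split; nra.
have a1 : a != 0 by apply/eqP => a1; move: b0; rewrite ba a1 mul0r ltxx.
exists (u / a); rewrite ba mulrA divfK // (_ : u * 3 = u *+ 2 + u); last by ring.
have -> : cos (u *+ 2 + u) = c ^+ 3 *+ 4 - c *+ 3.
  rewrite cosD cos_mulr2n sin_mulr2n cu.
  by rewrite -mulrnAl -mulrA -expr2 sin2cos2 cu; ring.
have -> : cos u - (c ^+ 3 *+ 4 - c *+ 3) = 8 / (3 * Num.sqrt 3).
  rewrite cu (_ : _ - _ = c * 4 - (c ^+ 2 * 3) * c * (4 / 3)); last by field.
  by rewrite c3 /c; field; rewrite gt_eqF.
exact: ler_norm.
Qed.

(** * Continuity and periodicity *)

Lemma second_difference (V : zmodType) (p q r : V) :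
  p - q - (q - r) = p + r - q *+ 2.
Proof. by rewrite opprB addrACA mulr2n opprD. Qed.

Lemma telescope_difference (V : zmodType) (x y c d e : V) :
  (x - c - e) + ((y - x) - d) = y - c - (e + d).
Proof. by rewrite addrACA -opprD; congr (_ - _); rewrite addrC addrA subrK. Qed.

Section CloseToScalarCosine.
Context {R : realType} {A : completeNormedModType (Cplx R)}.
Context {B : banach_algebra A}.
Local Notation AB := (balg R A B).
Variable C : R -> AB.
Hypothesis C0 : C 0 = 1.
Hypothesis CD : forall s t, C (s + t) + C (s - t) = (C s * C t) *+ 2.
Variables a m : R.
Hypothesis m2 : m < 2.
Hypothesis Cclose : forall t, rnorm (C t - (cos (a * t))%:C%C%:A) <= m.

Lemma cosine_dist1 t : rnorm (1 - C t) <= m + `|1 - cos (a * t)|.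
Proof.
have -> : 1 - C t = (1 - cos (a * t))%:C%C *: 1 - (C t - (cos (a * t))%:C%C%:A).
  by rewrite rmorphB scalerBl scale1r opprB addrA subrK.
rewrite (le_trans (rnormB _ _))// addrC lerD //.
by rewrite rnormZr rnorm1 mulr1.
Qed.

Lemma cosine_dist1_le4 t : rnorm (1 - C t) <= 4.
Proof.
rewrite (le_trans (cosine_dist1 t))//.
have c1 := cos_le1 (a * t); have c2 := cos_geN1 (a * t).
rewrite ger0_norm ?subr_ge0 //.
have m2' := m2; lra.
Qed.

Lemma cosine_le5 t : rnorm (C t) <= 5.
Proof.
rewrite -[C t](subKr 1) (le_trans (rnormB _ _))// rnorm1.
have := cosine_dist1_le4 t; lra.
Qed.

(** For small [t], |1 - C (t / 2)| <= |1 - C t| / 2; iterating from the crude bound 4 gives 4 / 2^i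
    on |t| <= d / 2^i. *)
Lemma cosine_continuous0 (e : R) : 0 < e ->
  exists2 d : R, 0 < d & forall t, `|t| <= d -> rnorm (1 - C t) <= e.
Proof.
(* The midpoint [m'] of [m] and 2 leaves the margin m' - m for |1 - cos (a t)|. *)
move=> e0; have m2' := m2; pose m' := (m + 2) / 2.
have m'2 : m' < 2 by rewrite /m'; lra.
have [k [n0 [k0 kn esc]]] := escapes_exists _ m'2.
have [d0 d00 Hd0] : exists2 d : R, 0 < d &
    forall x, `|x| <= d -> `|1 - cos x| <= m' - m.
  have /cvgrPdist_lt/(_ (m' - m)) := @continuous_cos R 0.
  have mm : 0 < m' - m by rewrite /m'; lra.
  move=> /(_ mm)/nbhs_ballP[r /= r0 Hr].
  exists (r / 2); first by rewrite divr_gt0.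
  move=> x xr; have xr' : `|0 - x| < r by rewrite sub0r normrN (le_lt_trans xr) //; lra.
  by have := Hr x xr'; rewrite /= cos0; exact: ltW.
have n00 : (0 < n0)%N by rewrite (leq_trans _ kn) // muln_gt0.
have n0R : 0 < n0%:R :> R by rewrite ltr0n.
have k2R : 0 < (2 * k)%:R :> R by rewrite ltr0n muln_gt0.
have a1 : 0 < `|a| + 1 by rewrite ltr_wpDl.
(* For |t| <= d and s = t / (2 k), every |a n s| with n <= n0 is at most d0; the added 1 covers a =
   0. *)
pose d := d0 / (`|a| + 1) / n0%:R * (2 * k)%:R.
have dpos : 0 < d by rewrite mulr_gt0 // !divr_gt0.
have half t : `|t| <= d -> rnorm (1 - C (t / 2)) <= rnorm (1 - C t) / 2.
  move=> td; pose s := t / (2 * k)%:R.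
  have -> : t / 2 = k%:R * s.
    by rewrite /s natrM; field; rewrite pnatr_eq0 -lt0n k0.
  have {1}-> : t = (2 * k)%:R * s by rewrite /s mulrC divfK ?gt_eqF.
  apply: (cosine_halving _ C0 CD _ cosine_dist1_le4 _ _ _ _ m'2 esc kn) => n nn0.
  rewrite (le_trans (cosine_dist1 _))// -lerBrDl Hd0 //.
  have sb : n%:R * `|s| <= d0 / (`|a| + 1).
    rewrite (@le_trans _ _ (n0%:R * `|s|)) ?ler_wpM2r ?ler_nat //.
    rewrite mulrC -ler_pdivlMr // /s normf_div (ger0_norm (ltW k2R)).
    by rewrite ler_pdivrMr.
  rewrite normrM [`|n%:R * s|]normrM (ger0_norm (ler0n R n)).
  rewrite (@le_trans _ _ ((`|a| + 1) * (d0 / (`|a| + 1)))) //.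
    by apply: ler_pM; rewrite ?mulr_ge0 ?lerDl.
  by rewrite mulrC divfK ?gt_eqF.
have pow i : forall t, `|t| <= d / 2 ^+ i -> rnorm (1 - C t) <= 4 / 2 ^+ i.
  elim: i => [|i IH] t; first by rewrite expr0 !divr1 => _; exact: cosine_dist1_le4.
  have i0 : 0 < 2 ^+ i :> R by rewrite exprn_gt0.
  rewrite exprS invfM mulrCA => td.
  have t2 : `|t * 2| <= d / 2 ^+ i by rewrite normrM [`|2|]ger0_norm //; lra.
  have := half (t * 2); rewrite mulfK // => /(_ _)H.
  have {}H := H (le_trans t2 _); have := IH _ t2.
  have dd : d / 2 ^+ i <= d.
    by rewrite ler_pdivrMr // ler_peMr ?(ltW dpos) // exprn_ege1 // ler1n.
  by have := H dd; rewrite mulrCA; lra.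
have half01 : 0 <= (2^-1 : R) < 1 by apply/andP; split; lra.
have e4 : 0 < e / 4 by rewrite divr_gt0.
have [i /(_ _ (leqnn i)) Hi] := expr_small _ _ half01 e4.
exists (d / 2 ^+ i); first by rewrite divr_gt0 // exprn_gt0.
move=> t /pow /le_trans -> //; rewrite -exprVn; lra.
Qed.

(** At multiples of [tau] the scalar cosine is 1, so [cosine_dist1] gives the bound [m] itself.
    Halving then bounds |1 - C (k tau)| by 4 / 2^j for every j. *)
Lemma cosine_period : exists2 T : R, 0 < T & C T = 1.
Proof.
have [k [n0 [k0 kn esc]]] := escapes_exists _ m2.
have [tau tau0 Htau] : exists2 tau : R, 0 < tau & forall n : nat, cos (a * (n%:R * tau)) = 1.
  have [->|a0] := eqVneq a 0; first by exists 1 => // n; rewrite mul0r cos0.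
  have na : `|a| != 0 by rewrite normr_eq0.
  exists (pi *+ 2 / `|a|); first by rewrite divr_gt0 ?normr_gt0 // mulrn_wgt0 // pi_gt0.
  move=> n; rewrite -cos_norm !normrM (ger0_norm (ler0n _ _)) -[RHS]cos0 -(cosDn 0 n) add0r.
  congr cos; rewrite normfV normr_id (ger0_norm (mulrn_wge0 2 (pi_ge0 R))).
  by rewrite mulrCA; congr (_ * _); rewrite mulrC divfK.
exists (k%:R * tau); first by rewrite mulr_gt0 // ltr0n.
have half j : rnorm (1 - C (2 ^+ j * (k%:R * tau))) <=
    rnorm (1 - C (2 ^+ j.+1 * (k%:R * tau))) / 2.
  have -> : 2 ^+ j * (k%:R * tau) = k%:R * (2 ^+ j * tau) by rewrite mulrCA.
  have -> : 2 ^+ j.+1 * (k%:R * tau) = (2 * k)%:R * (2 ^+ j * tau).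
    by rewrite exprS natrM; ring.
  apply: (cosine_halving _ C0 CD _ cosine_dist1_le4 _ _ _ _ m2 esc kn) => n nn0.
  rewrite (le_trans (cosine_dist1 _))//.
  have -> : n%:R * (2 ^+ j * tau) = (n * 2 ^ j)%:R * tau by rewrite mulrA natrM natrX.
  by rewrite Htau subrr normr0 addr0.
have pow j : rnorm (1 - C (k%:R * tau)) <= 4 / 2 ^+ j.
  suff : rnorm (1 - C (k%:R * tau)) <= rnorm (1 - C (2 ^+ j * (k%:R * tau))) / 2 ^+ j.
    move=> /le_trans -> //; rewrite ler_pM2r ?invr_gt0 ?exprn_gt0 //.
    exact: cosine_dist1_le4.
  elim: j => [|j IH]; first by rewrite expr0 mul1r divr1.
  rewrite (le_trans IH) // (_ : _ / 2 ^+ j.+1 =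
    rnorm (1 - C (2 ^+ j.+1 * (k%:R * tau))) / 2 / 2 ^+ j).
    by rewrite ler_pM2r ?invr_gt0 ?exprn_gt0.
  by rewrite -mulrA -invfM -exprS.
apply/eqP; rewrite eq_sym -subr_eq0; apply/eqP.
apply: (@rnorm_small0 _ _ _ _ 1) => e e0; rewrite mul1r.
have half01 : 0 <= (2^-1 : R) < 1 by apply/andP; split; lra.
have e4 : 0 < e / 4 by rewrite divr_gt0.
have [i /(_ _ (leqnn i)) Hi] := expr_small _ _ half01 e4.
by rewrite (le_trans (pow i)) // -exprVn; lra.
Qed.

(** As [C T = 1], second differences vanish along t + n T, so C (t + n T) is affine in [n]; being
    bounded, it is constant. *)
Lemma cosine_periodic T t : C T = 1 -> C (t + T) = C t.
Proof.
move=> CT; pose D := C (t + T) - C t.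
have H n : C (t + n%:R * T) = C t + D *+ n /\ C (t + n.+1%:R * T) = C t + D *+ n.+1.
  elim: n => [|n [IH1 IH2]].
    by split; [rewrite mul0r mulr0n !addr0|rewrite mul1r mulr1n /D [RHS]addrC subrK].
  split=> //; have := CD (t + n.+1%:R * T) T; rewrite CT mulr1.
  have -> : t + n.+1%:R * T + T = t + n.+2%:R * T by rewrite -(natr1 n.+1); ring.
  have -> : t + n.+1%:R * T - T = t + n%:R * T by rewrite -(natr1 n); ring.
  rewrite IH1 IH2 => /(canRL (addrK _)) ->.
  rewrite mulr2n -addrA (_ : C t + D *+ n.+1 - (C t + D *+ n) = D).
    by rewrite -addrA -mulrSr.
  by rewrite opprD addrACA subrr add0r mulrS addrK.
apply/eqP; rewrite -subr_eq0; apply/eqP; apply: (@rnorm_small0 _ _ _ _ 10) => e e0.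
pose n := (Num.trunc e^-1).+1.
have ne : e^-1 < n%:R by exact: truncnS_gt.
have n0 : 0 < n%:R :> R by rewrite ltr0n.
have : rnorm (D *+ n) <= 10.
  rewrite -[D *+ n](addrK (C t)) addrC -[_ + C t]addrC -(H n).1 addrC.
  rewrite (le_trans (rnormB _ _))//.
  have := cosine_le5 t; have := cosine_le5 (t + n%:R * T); lra.
rewrite -scaler_nat -(rmorph_nat (real_complex R)) rnormZr ger0_norm //.
rewrite mulrC -ler_pdivlMr // => /le_trans -> //.
by rewrite ler_pM2l // -[leRHS]invrK lef_pV2 ?posrE ?invr_gt0 // ltW.
Qed.

(* Second differences at step h are of size |1 - C(h)|, so a large first difference
   at step h would accumulate over many steps and contradict boundedness. *)
Lemma cosine_continuous (e : R) : 0 < e ->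
  exists2 d : R, 0 < d & forall u h, `|h| <= d -> rnorm (C (u + h) - C u) <= e.
Proof.
move=> e0; pose n := (Num.trunc (20 / e)).+1.
have ne : 20 / e < n%:R by exact: truncnS_gt.
have n0 : 0 < n%:R :> R by rewrite ltr0n.
(* The accumulated estimate will read n |D u| <= 10 + 10 eta n^2; this choice turns the last term
   into n e / 2, and n > 20 / e makes 10 smaller than n e / 2. *)
pose eta := e / (20 * n%:R).
have eta0 : 0 < eta by rewrite divr_gt0 // mulr_gt0.
have [d d0 Hd] := cosine_continuous0 _ eta0.
exists d => // u h /Hd hd.
pose D u := C (u + h) - C u.
have DD v : rnorm (D (v + h) - D v) <= 10 * eta.
  have -> : D (v + h) - D v = (C (v + h) * (C h - 1)) *+ 2.
    by rewrite mulrBr mulr1 mulrnBl -CD addrK /D second_difference.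
  rewrite mulr2n (le_trans (rnormD _ _))//.
  have := rnormM (C (v + h)) (C h - 1); rewrite rdistC.
  have := cosine_le5 (v + h); have := rnorm_ge0 (1 - C h).
  have := rnorm_ge0 (C (v + h)); nra.
have Dn i v : rnorm (D (v + i%:R * h) - D v) <= 10 * eta * i%:R.
  elim: i => [|i IH]; first by rewrite mul0r addr0 subrr rnorm0 mulr0.
  rewrite -natr1 mulrDl mul1r addrA -(subrK (D (v + i%:R * h)) (D (_ + h))) -addrA.
  by rewrite (le_trans (rnormD _ _))// mulrDr mulr1 [leRHS]addrC lerD.
have e10 : 0 < 10 * eta by exact: mulr_gt0.
have Cn i : rnorm (C (u + i%:R * h) - C u - D u *+ i) <= 10 * eta * i%:R ^+ 2.
  elim: i => [|i IH]; first by rewrite mul0r addr0 subrr mulr0n subrr rnorm0 expr0n mulr0.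
  have -> : C (u + i.+1%:R * h) - C u - D u *+ i.+1 =
      (C (u + i%:R * h) - C u - D u *+ i) + (D (u + i%:R * h) - D u).
    have -> : D (u + i%:R * h) = C (u + i.+1%:R * h) - C (u + i%:R * h).
      by rewrite /D -(natr1 i) mulrDl mul1r addrA.
    by rewrite telescope_difference -mulrSr.
  rewrite (le_trans (rnormD _ _))// (le_trans (lerD IH (Dn _ _)))//.
  rewrite -mulrDr (ler_pM2l e10) -natr1.
  have : 0 <= i%:R :> R by []; nra.
have : rnorm (D u *+ n) <= 10 + 10 * eta * n%:R ^+ 2.
  rewrite -[D u *+ n](subKr (C (u + n%:R * h) - C u)) (le_trans (rnormB _ _))//.
  apply: lerD (Cn n); rewrite (le_trans (rnormB _ _))//.
  have := cosine_le5 u; have := cosine_le5 (u + n%:R * h); lra.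
rewrite -[D u *+ n]scaler_nat -(rmorph_nat (real_complex R)) rnormZr ger0_norm //.
rewrite [n%:R * _]mulrC -ler_pdivlMr // => /le_trans -> //.
rewrite ltr_pdivrMr // in ne.
rewrite ler_pdivrMr // /eta.
have -> : 10 * (e / (20 * n%:R)) * n%:R ^+ 2 = e * n%:R / 2.
  by field; rewrite gt_eqF.
lra.
Qed.

End CloseToScalarCosine.

(** * Spectral decomposition *)

(** Telescoping: 2 sin y cos (2 (M + 1) y) is the difference of two consecutive right-hand sides. *)
Lemma dirichlet_kernel {R : realType} (y : R) (M : nat) :
  sin y * (\sum_(j < M.+1) (if j == 0 :> nat then 1 else 2) * cos (j%:R * (y *+ 2))) =
  sin ((M.*2.+1)%:R * y).
Proof.
elim: M => [|M IH].
  by rewrite big_ord_recl big_ord0 /= mul0r cos0 !mulr1 addr0 mulr1 mul1r.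
rewrite big_ord_recr mulrDr {}IH /=.
have -> : (M.+1).*2.+1%:R * y = M.+1%:R * (y *+ 2) + y.
  by rewrite -addnn -!(natr1 _) -mulr_natr natrD -!(natr1 _); ring.
have -> : M.*2.+1%:R * y = M.+1%:R * (y *+ 2) - y.
  by rewrite -addnn -!(natr1 _) -mulr_natr natrD; ring.
by rewrite sinB sinD; ring.
Qed.

(** * Discrete cosine transform over a period *)

Section Eigenprojections.
Context {R : realType} {A : completeNormedModType (Cplx R)}.
Context {B : banach_algebra A}.
Local Notation AB := (balg R A B).
Variable C : R -> AB.
Hypothesis C0 : C 0 = 1.
Hypothesis CD : forall s t, C (s + t) + C (s - t) = (C s * C t) *+ 2.
Variables (T : R) (M : nat).
Hypothesis T0 : 0 < T.
Hypothesis CT : forall t, C (t + T) = C t.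
Local Notation N := (M.*2.+1).
Local Notation t0 := (T / N%:R).

Definition freq (j : nat) : R := j%:R * (pi *+ 2) / T.

(** A discrete cosine transform of [N] samples of [C]. Frequencies j and -j are merged, hence the
    weight 2 for j > 0; as N = 2 M + 1 is odd, 0 is the only frequency equal to its opposite modulo
    N. *)
Definition eigenproj (j : nat) : AB :=
  ((if j == 0%N then 1 else 2) / N%:R)%:C%C *:
    \sum_(n < N) (cos (freq j * (n%:R * t0)))%:C%C *: C (n%:R * t0).

Let N0 : 0 < N%:R :> R. Proof. by rewrite ltr0n. Qed.
Let t00 : 0 < t0. Proof. exact: divr_gt0. Qed.
Let Nt0 : N%:R * t0 = T. Proof. by rewrite mulrC divfK ?gt_eqF. Qed.

Lemma freqT j : freq j * T = j%:R * (pi *+ 2).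
Proof. by rewrite /freq divfK // gt_eqF. Qed.

(** After exchanging the sums, the coefficient of C (n t0) is a Dirichlet kernel at pi n / N divided
    by N: it vanishes for 0 < n < N and is (1 + 2 M) / N = 1 for n = 0. *)
Lemma eigenproj_sum : \sum_(j < M.+1) eigenproj j = 1.
Proof.
have E j : eigenproj j = \sum_(n < N)
    ((if j == 0%N then 1 else 2) * cos (j%:R * ((pi * n%:R / N%:R) *+ 2)) / N%:R)%:C%C
      *: C (n%:R * t0).
  rewrite /eigenproj scaler_sumr; apply: eq_bigr => n _; rewrite scalerA -rmorphM.
  congr (_%:C%C *: _); rewrite mulrAC; congr (_ * cos _ / _).
  rewrite -mulr_natr -[X in X * _ = _]/(_ / T); field.
  by rewrite !gt_eqF.
under eq_bigr do rewrite E.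
rewrite exchange_big /= big_ord_recl /= [X in _ + X]big1 ?addr0 => [|n _].
  rewrite mul0r C0 -scaler_suml -rmorph_sum -mulr_suml.
  under eq_bigr do rewrite mulr0 mul0r mul0rn mulr0 cos0 mulr1.
  rewrite big_ord_recl /= sumr_const card_ord -[2 *+ M]mulr_natr.
  rewrite (_ : 1 + _ = N%:R) ?divff ?gt_eqF ?scale1r //.
  by rewrite -natrM -natr1 addrC mul2n.
rewrite -scaler_suml -rmorph_sum -mulr_suml.
set y : R := pi * (bump 0 n)%:R / N%:R.
have y0 : sin y != 0.
  rewrite gt_eqF // sin_gt0_pi // /y /bump add1n.
  rewrite divr_gt0 ?mulr_gt0 ?pi_gt0 ?ltr0n //= ltr_pdivrMr // ltr_pM2l ?pi_gt0 //.
  by rewrite ltr_nat ltnS ltn_ord.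
have yN : sin (N%:R * y) = 0.
  rewrite /y mulrC divfK ?gt_eqF // mulr_natr.
  by rewrite -[_ *+ _]add0r (alternatingn (@sinDpi R)) sin0 mulr0.
have /eqP := dirichlet_kernel y M; rewrite yN mulf_eq0 (negPf y0) /= => /eqP ->.
by rewrite mul0r scale0r.
Qed.

Lemma sum_shift (g : R -> AB) : (forall t, g (t + T) = g t) ->
  \sum_(n < N) g (n%:R * t0 + t0) = \sum_(n < N) g (n%:R * t0).
Proof.
move=> gT; rewrite big_ord_recr big_ord_recl /= addrC; congr (_ + _).
  rewrite mul0r -[RHS]gT add0r; congr g.
  by rewrite -[RHS]Nt0 -[X in _ + X = _]mul1r -mulrDl natr1.
by apply: eq_bigr => n _; rewrite /bump /= add1n -(natr1 n) mulrDl mul1r.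
Qed.

Lemma cos_freqDT j t : cos (freq j * (t + T)) = cos (freq j * t).
Proof. by rewrite mulrDr freqT cosDn. Qed.

(** The functional equation turns 2 C t0 C (n t0) into two shifted samples; periodicity moves the
    shifts onto the cosine weights, where the addition formula extracts cos (freq j t0). *)
Lemma eigenproj_eigen j : C t0 * eigenproj j = (cos (freq j * t0))%:C%C *: eigenproj j.
Proof.
rewrite /eigenproj -scalerAr [RHS]scalerA [X in _ = X *: _]mulrC -[RHS]scalerA.
congr (_ *: _); apply: balg_mulr2n_inj.
set b := freq j.
rewrite mulr_sumr -sumrMnl.
have -> : \sum_(n < N) (C t0 * ((cos (b * (n%:R * t0)))%:C%C *: C (n%:R * t0))) *+ 2 =
  \sum_(n < N) (cos (b * (n%:R * t0)))%:C%C *: C (n%:R * t0 + t0) +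
  \sum_(n < N) (cos (b * (n%:R * t0)))%:C%C *: C (n%:R * t0 - t0).
  rewrite -big_split /=; apply: eq_bigr => n _.
  by rewrite -scalerAr (cosine_comm _ C0 CD) -scalerDr CD scalerMnr.
pose g1 s := (cos (b * (s - t0)))%:C%C *: C s.
pose g2 s := (cos (b * s))%:C%C *: C (s - t0).
have -> : \sum_(n < N) (cos (b * (n%:R * t0)))%:C%C *: C (n%:R * t0 + t0) =
    \sum_(n < N) g1 (n%:R * t0).
  rewrite -sum_shift => [|t]; first by apply: eq_bigr => n _; rewrite /g1 addrK.
  by rewrite /g1 CT addrAC cos_freqDT.
have -> : \sum_(n < N) (cos (b * (n%:R * t0)))%:C%C *: C (n%:R * t0 - t0) =
    \sum_(n < N) g2 (n%:R * t0 + t0).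
  rewrite sum_shift // => t.
  by rewrite /g2 addrAC CT cos_freqDT.
rewrite scaler_sumr -sumrMnl -big_split /=; apply: eq_bigr => n _.
rewrite /g1 /g2 addrK -scalerDl -rmorphD scalerA -rmorphM scalerMnl -rmorphMn.
by congr (_%:C%C *: _); rewrite mulrBr mulrDr cosB cosD; ring.
Qed.

Lemma eigenproj_comm j t : C t * eigenproj j = eigenproj j * C t.
Proof.
rewrite /eigenproj -scalerAr -scalerAl mulr_sumr mulr_suml; congr (_ *: _).
by apply: eq_bigr => n _; rewrite -scalerAr (cosine_comm _ C0 CD t) scalerAl.
Qed.

Lemma freq_t0 j : freq j * t0 = j%:R * (pi *+ 2) / N%:R.
Proof. by rewrite mulrA freqT. Qed.

Lemma freq_t0_itv j : (j <= M)%N -> 0 <= freq j * t0 <= pi.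
Proof.
have pi0 := pi_gt0 R; move=> jM; rewrite freq_t0; apply/andP; split.
  by rewrite divr_ge0 // mulr_ge0 // mulrn_wge0 // ltW.
rewrite ler_pdivrMr // -[pi *+ 2]mulr_natl mulrA [leRHS]mulrC ler_pM2r // -natrM ler_nat.
by rewrite muln2 (leq_trans (_ : _ <= M.*2)%N) // leq_double.
Qed.

(** The product is an eigenvector of [C t0] for both cosines, and these differ: the angles freq i t0
    and freq j t0 are distinct points of [0, pi], where cos is injective. *)
Lemma eigenproj_orth i j : (i <= M)%N -> (j <= M)%N -> i != j ->
  eigenproj i * eigenproj j = 0.
Proof.
move=> iM jM ij.
have E : (cos (freq i * t0))%:C%C *: (eigenproj i * eigenproj j) =
    (cos (freq j * t0))%:C%C *: (eigenproj i * eigenproj j).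
  rewrite scalerAl -eigenproj_eigen eigenproj_comm -mulrA eigenproj_eigen.
  by rewrite -scalerAr.
have : (cos (freq i * t0) - cos (freq j * t0))%:C%C *: (eigenproj i * eigenproj j) = 0.
  by rewrite rmorphB scalerBl E subrr.
move=> /eqP; rewrite scaler_eq0 => /orP[|/eqP //].
rewrite -(rmorph0 (real_complex R)) => /eqP/complexI/eqP; rewrite subr_eq0 => /eqP.
move=> /cos_inj; rewrite !in_itv /= => /(_ (freq_t0_itv _ iM) (freq_t0_itv _ jM)).
move=> /(mulIf (lt0r_neq0 t00))/(congr1 ( *%R^~ T)); rewrite !freqT.
have pi20 : pi *+ 2 != 0 :> R by rewrite mulrn_eq0 /= gt_eqF // pi_gt0.
by move=> /(mulIf pi20)/eqP; rewrite eqr_nat (negPf ij).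
Qed.

(** Multiplying [eigenproj_sum] by the projection leaves one term, by orthogonality. *)
Lemma eigenproj_idem j : (j <= M)%N -> eigenproj j * eigenproj j = eigenproj j.
Proof.
move=> jM; rewrite -[RHS]mulr1 -eigenproj_sum mulr_sumr.
rewrite (bigD1 (Ordinal (jM : (j < M.+1)%N))) //= big1 ?addr0 // => i ij.
rewrite -val_eqE /= eq_sym in ij; exact: eigenproj_orth jM (leq_ord i) ij.
Qed.

Hypothesis Csmall : forall t, `|t| <= t0 -> rnorm (1 - C t) <= 2^-1.
Hypothesis Ccont : forall e : R, 0 < e ->
  exists2 d : R, 0 < d & forall u h, `|h| <= d -> rnorm (C (u + h) - C u) <= e.

(* If u^2 p = c^2 p then u + c annihilates (u - c) p; but c >= 0 and u is close to 1,
   so u + c is bounded below. *)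
Lemma eigen_half (b s : R) (p : AB) : 0 <= s <= t0 -> 0 <= b * s <= pi ->
  C s * p = (cos (b * s))%:C%C *: p ->
  C (s / 2) * p = (cos (b * (s / 2)))%:C%C *: p.
Proof.
move=> /andP[s0 st] /andP[bs0 bspi] Hs.
set u := C (s / 2); set c := cos (b * (s / 2)).
have c0 : 0 <= c.
  by apply: cos_ge0_pihalf; rewrite mulrA; apply/andP; split; lra.
have u2 : (u * u) *+ 2 = C s + 1 by rewrite -CD subrr C0 -splitr.
have c2 : (c * c) *+ 2 = cos (b * s) + 1.
  rewrite (_ : b * s = (b * (s / 2)) *+ 2); first by rewrite cos_mulr2n subrK.
  by rewrite -mulr_natr; field.
have up : u * (u * p) = (c * c)%:C%C *: p.
  apply: balg_mulr2n_inj; rewrite mulrA -mulrnAl u2 mulrDl mul1r Hs.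
  by rewrite scalerMnl -rmorphMn /= c2 rmorphD scalerDl scale1r.
pose v := u * p - c%:C%C *: p.
have uv : u * v = - (c%:C%C *: v).
  rewrite /v mulrBr up -scalerAr scalerBr scalerA -rmorphM opprB.
  by [].
have : (1 + c)%:C%C *: v = (1 - u) * v.
  by rewrite rmorphD scalerDl scale1r mulrBl mul1r uv opprK.
move=> /(congr1 rnorm); rewrite rnormZr ger0_norm ?addr_ge0 // => E.
have us : rnorm (1 - u) <= 2^-1.
  apply: Csmall; rewrite ger0_norm ?divr_ge0 // (le_trans _ st) //.
  by rewrite ler_pdivrMr // ler_peMr // ler1n.
have := rnormM (1 - u) v; rewrite -E => H.
have v0 : rnorm v = 0 by have := rnorm_ge0 v; nra.
by apply/eqP; rewrite -subr_eq0; apply/eqP; exact: rnorm_eq0.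
Qed.

Lemma eigen_mul (b s : R) (p : AB) n : C s * p = (cos (b * s))%:C%C *: p ->
  C (n%:R * s) * p = (cos (b * (n%:R * s)))%:C%C *: p.
Proof.
move=> Hs; suff [] : C (n%:R * s) * p = (cos (b * (n%:R * s)))%:C%C *: p /\
  C (n.+1%:R * s) * p = (cos (b * (n.+1%:R * s)))%:C%C *: p by [].
elim: n => [|n [IH1 IH2]]; first by rewrite mul0r mulr0 cos0 scale1r C0 !mul1r.
split=> //; rewrite (cosine_SS _ C0 CD) mulrBl (mulrnAl (C s * _)) -mulrA IH1 IH2 -scalerAr Hs.
rewrite scalerA -rmorphM scalerMnl -rmorphMn -scalerBl -rmorphB.
by congr (_%:C%C *: _); rewrite ![b * (_ * s)]mulrCA cos_mulSS [cos (b * s) * _]mulrC.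
Qed.

(** The eigenvalue equation descends to t0 / 2^i by [eigen_half], passes to multiples by
    [eigen_mul], and reaches every [t] by continuity. The range of b t0 fixes the sign of the cosine
    at each halving. *)
Lemma eigen_all (b : R) (p : AB) : 0 <= b * t0 <= pi ->
  C t0 * p = (cos (b * t0))%:C%C *: p -> forall t, C t * p = (cos (b * t))%:C%C *: p.
Proof.
move=> /andP[b0 bpi] Hp t.
wlog tpos : t / 0 <= t.
  move=> H; have [tp|tn] := leP 0 t; first exact: H.
  rewrite -[t]opprK (cosine_even _ C0 CD) [in RHS]mulrN cosN; apply: H.
  by rewrite oppr_ge0 ltW.
have Hi i : 0 < t0 / 2 ^+ i <= t0 /\
    C (t0 / 2 ^+ i) * p = (cos (b * (t0 / 2 ^+ i)))%:C%C *: p.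
  elim: i => [|i [/andP[s0 st] IH]]; first by rewrite expr0 divr1 t00 lexx.
  have bs : 0 <= b * (t0 / 2 ^+ i) <= pi.
    have i1 : 1 <= 2 ^+ i :> R by rewrite exprn_ege1 // ler1n.
    have i0 : 0 < 2 ^+ i :> R by rewrite exprn_gt0.
    rewrite mulrA divr_ge0 ?(ltW i0) //= ler_pdivrMr // (le_trans bpi) //.
    by rewrite ler_peMr // pi_ge0.
  rewrite exprSr invfM [t0 * (_ * _)]mulrA; move: (t0 / 2 ^+ i) s0 st bs IH => s s0 st bs IH.
  split; last by apply: eigen_half => //; rewrite (ltW s0).
  rewrite divr_gt0 //= (le_trans _ st) // ler_pdivrMr // ler_peMr ?ler1n //.
  exact: ltW.
apply/eqP; rewrite -subr_eq0; apply/eqP.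
apply: (@rnorm_small0 _ _ _ _ (2 * rnorm p)) => e e0.
have [d d0 Hd] := Ccont _ e0.
have /cvgrPdist_lt/(_ _ e0)/nbhs_ballP[r /= r0 Hr] := @continuous_cos R (b * t).
pose eta := Num.min d (r / (`|b| + 1)).
have b1 : 0 < `|b| + 1 by rewrite ltr_wpDl.
have eta0 : 0 < eta by rewrite lt_min d0 divr_gt0.
have half01 : 0 <= (2^-1 : R) < 1 by apply/andP; split; lra.
have [i /(_ _ (leqnn i)) ie] := expr_small _ _ half01 (divr_gt0 eta0 t00).
have [/andP[s0 st] Hs] := Hi i.
move: Hs s0 st; have : t0 / 2 ^+ i < eta by rewrite mulrC -ltr_pdivlMr // -exprVn.
set s := t0 / 2 ^+ i => seta Hs s0 st.
(* The multiple n s approximates [t] from below within s < eta. *)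
pose n := Num.trunc (t / s).
have /andP[n1 n2] := truncn_itv (divr_ge0 tpos (ltW s0)).
rewrite ler_pdivlMr // -/n in n1; rewrite ltr_pdivrMr // -/n -natr1 mulrDl mul1r in n2.
have hs : `|t - n%:R * s| < eta by rewrite ger0_norm; lra.
move: hs; rewrite lt_min => /andP[hd hr].
have := eigen_mul _ _ _ n Hs; set x := n%:R * s in n1 n2 hd hr * => Hx.
have -> : C t * p - (cos (b * t))%:C%C *: p = (C t - C x) * p -
    (cos (b * t) - cos (b * x))%:C%C *: p.
  by rewrite mulrBl Hx rmorphB scalerBl opprB addrA subrK.
rewrite (le_trans (rnormB _ _)) // -mulrA mulr_natl mulr2n lerD //.
  rewrite (le_trans (rnormM _ _)) // mulrC ler_wpM2l //.
  by have := Hd x (t - x) (ltW hd); rewrite (addrC x) subrK.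
rewrite rnormZr [leRHS]mulrC ler_wpM2r // ltW //; apply: Hr.
rewrite /ball /= -mulrBr normrM (@le_lt_trans _ _ ((`|b| + 1) * `|t - x|)) //.
  by rewrite ler_wpM2r // lerDl.
by rewrite mulrC -ltr_pdivlMr.
Qed.

End Eigenprojections.

(** Helly's theorem on the line: the supremum of the left endpoints lies below every right
    endpoint. *)
Lemma common_center {R : realType} (E : set (R * R)) : E !=set0 ->
  (forall x y, E x -> E y -> `|x.1 - y.1| <= x.2 + y.2) ->
  exists l, forall x, E x -> `|x.1 - l| <= x.2.
Proof.
move=> [x0 Ex0] HE; pose L := [set x.1 - x.2 | x in E].
have ub y : E y -> ubound L (y.1 + y.2).
  move=> Ey _ [x Ex <-]; have := HE _ _ Ex Ey.
  by rewrite ler_norml => /andP[]; lra.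
have L0 : L !=set0 by exists (x0.1 - x0.2), x0.
exists (sup L) => x Ex.
have h1 : x.1 - x.2 <= sup L.
  by apply: ub_le_sup; [exists (x0.1 + x0.2); exact: ub|exists x].
have h2 : sup L <= x.1 + x.2 by apply: ge_sup => //; exact: ub.
by rewrite ler_norml; apply/andP; split; lra.
Qed.

Section LineClosed.
Context {R : realType} {A : completeNormedModType (Cplx R)}.
Context {B : banach_algebra A}.
Local Notation AB := (balg R A B).

(* The admissible coefficients c within precision e are pairwise e + e' close, so
   their real and imaginary parts have a common center. *)
Lemma line_closed (p z : AB) : p != 0 ->
  (forall e : R, 0 < e -> exists c : Cplx R, rnorm (z - c *: p) < e) ->
  exists c : Cplx R, z = c *: p.
Proof.
move=> p0 zp.
have np : 0 < rnorm p.
  by rewrite lt_neqAle rnorm_ge0 andbT eq_sym; apply: contra_neq p0; exact: rnorm_eq0.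
pose good (c : Cplx R) (e : R) := rnorm (z - c *: p) <= e * rnorm p.
have dist c c' e e' : good c e -> good c' e' -> Normc.normc (c - c') <= e + e'.
  rewrite /good => ce ce'; rewrite -(ler_pM2r np) -rnormZ mulrDl.
  rewrite (_ : _ *: p = (z - c' *: p) - (z - c *: p)).
    by rewrite (le_trans (rnormB _ _))// addrC lerD.
  by rewrite scalerBl opprB [RHS]addrC addrA subrK.
have ReIm (c : Cplx R) : `|complex.Re c| <= Normc.normc c /\ `|complex.Im c| <= Normc.normc c.
  case: c => x y /=; rewrite -![`|_|]sqrtr_sqr !ler_sqrt ?addr_ge0 ?sqr_ge0 //.
  by rewrite lerDl lerDr !sqr_ge0.
have ex e : 0 < e -> exists c, good c e.
  move=> e0; have [c Hc] := zp _ (mulr_gt0 e0 np); exists c; exact: ltW.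
have [c1 Hc1] := ex _ ltr01.
have [x Hx] : exists l, forall c e, good c e -> `|complex.Re c - l| <= e.
  have [||l Hl] := @common_center R [set q | exists2 c, good c q.2 & q.1 = complex.Re c].
  - by exists (complex.Re c1, 1), c1.
  - move=> [r e] [r' e'] [c /= ce ->] [c' /= ce' ->].
    by rewrite -raddfB (le_trans (ReIm _).1) // dist.
  by exists l => c e ce; apply: (Hl (complex.Re c, e)); exists c.
have [y Hy] : exists l, forall c e, good c e -> `|complex.Im c - l| <= e.
  have [||l Hl] := @common_center R [set q | exists2 c, good c q.2 & q.1 = complex.Im c].
  - by exists (complex.Im c1, 1), c1.
  - move=> [r e] [r' e'] [c /= ce ->] [c' /= ce' ->].
    by rewrite -raddfB (le_trans (ReIm _).2) // dist.
  by exists l => c e ce; apply: (Hl (complex.Im c, e)); exists c.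
exists (Complex x y); apply/eqP; rewrite -subr_eq0; apply/eqP.
apply: (@rnorm_small0 _ _ _ _ (3 * rnorm p)) => e e0.
have [c ce] := ex _ e0.
rewrite (_ : z - _ = (z - c *: p) + (c - Complex x y) *: p); last first.
  by rewrite scalerBl addrA subrK.
rewrite (le_trans (rnormD _ _))//.
have := Hx _ _ ce; have := Hy _ _ ce; move: ce; rewrite /good rnormZ.
case: c => a b /= ce hy hx.
have : Normc.normc (Complex (a - x) (b - y)) <= 2 * e.
  by rewrite (le_trans (normc_le_ReIm _ _))//; lra.
rewrite -[Complex (a - x) (b - y)]/(Complex a b - Complex x y).
move=> ab; rewrite (_ : 3 * rnorm p * e = e * rnorm p + 2 * e * rnorm p); last by ring.
by rewrite lerD // ler_wpM2r.
Qed.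

End LineClosed.

(** * Idempotent decomposition and the generated closed subalgebra *)

Section Decomposition.
Context {R : realType} {A : completeNormedModType (Cplx R)}.
Variable B : banach_algebra A.
Local Notation AB := (balg R A B).

Lemma subalg_sum (S : set AB) (I : Type) (r : seq I) (P : pred I) (F : I -> AB) :
  is_subalgebra B S -> (forall i, S (F i)) -> S (\sum_(i <- r | P i) F i).
Proof.
move=> [S1 [SD [SZ _]]] SF; elim/big_ind : _ => //.
by rewrite -(scale0r (1 : AB)); exact: SZ.
Qed.

Lemma eigenproj_subalg (C : R -> AB) (S : set AB) T M j :
  is_subalgebra B S -> range C `<=` S -> S (eigenproj C T M j).
Proof.
move=> SS CS; have [_ [_ [SZ _]]] := SS; apply: (SZ); apply: subalg_sum => // n.
by apply: SZ; apply: CS; exists (n%:R * (T / M.*2.+1%:R)).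
Qed.

Lemma cosine_decomposition (C : R -> AB) (a m : R) : C 0 = 1 ->
  (forall s t, C (s + t) + C (s - t) = (C s * C t) *+ 2) -> m < 2 ->
  (forall t, rnorm (C t - (cos (a * t))%:C%C%:A) <= m) ->
  exists (k : nat) (p : 'I_k -> AB) (b : 'I_k -> R),
    [/\ [/\ forall j, closed_subalg_gen B (range C) (p j),
      forall j, p j != 0, forall j, p j * p j = p j,
      forall i j, i != j -> p i * p j = 0 & \sum_j p j = 1],
      injective b, forall j, Omega a m (b j) &
      forall t, C t = \sum_j (cos (b j * t))%:C%C *: p j].
Proof.
move=> C0 CD m2 Cclose.
have [T T0 CT1] := cosine_period _ C0 CD _ _ m2 Cclose.
have CT t : C (t + T) = C t by exact: (cosine_periodic _ CD _ _ m2 Cclose _ t CT1).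
have half0 : 0 < 2^-1 :> R by rewrite invr_gt0.
have [d d0 Hd] := cosine_continuous0 _ C0 CD _ _ m2 Cclose _ half0.
pose M := Num.trunc (T / d).
have TM : T / M.*2.+1%:R <= d.
  rewrite ler_pdivrMr ?ltr0n // mulrC -ler_pdivrMr // ltW //.
  rewrite (lt_le_trans (truncnS_gt _)) // ler_nat ltnS -addnn leq_addr //.
have Csmall t : `|t| <= T / M.*2.+1%:R -> rnorm (1 - C t) <= 2^-1.
  by move=> tT; apply: Hd; exact: le_trans tT TM.
have Ccont := cosine_continuous _ C0 CD _ _ m2 Cclose.
pose q (j : 'I_M.+1) := eigenproj C T M j.
(* Vanishing projections are discarded: the sum is unchanged, and membership in [Omega] is obtained
   by dividing by the norm of [q j]. *)
pose D : {set 'I_M.+1} := finset (fun j => q j != 0).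
have Cq j t : C t * q j = (cos (freq T j * t))%:C%C *: q j.
  apply: (eigen_all _ C0 CD _ _ T0 Csmall Ccont).
    exact: (freq_t0_itv _ _ T0 _ (leq_ord j)).
  exact: (eigenproj_eigen _ C0 CD _ _ T0 CT).
have qsum : \sum_(i < #|D|) q (enum_val i) = 1.
  rewrite -(eigenproj_sum _ C0 T M T0) -(big_enum_val q) /= [RHS](bigID (fun j => j \in D)) /=.
  by rewrite [X in _ = _ + X]big1 ?addr0 // => j; rewrite inE negbK => /eqP.
have qn0 (j : 'I_#|D|) : q (enum_val j) != 0 by have := enum_valP j; rewrite inE.
exists #|D|, (fun i => q (enum_val i)), (fun i => freq T (enum_val i : 'I_M.+1)).
split; first split => //.
- by move=> j S _ SS CS; exact: (eigenproj_subalg C S T M (enum_val j) SS CS).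
- by move=> j; exact: (eigenproj_idem _ C0 CD _ _ T0 CT _ (leq_ord _)).
- move=> i j ij; apply: (eigenproj_orth _ C0 CD _ _ T0 CT _ _ (leq_ord _) (leq_ord _)).
  by apply: contra_neq ij => /val_inj/enum_val_inj.
- move=> i j /(congr1 ( *%R^~ T)); rewrite !freqT //.
  have pi20 : pi *+ 2 != 0 :> R by rewrite mulrn_eq0 /= gt_eqF // pi_gt0.
  by move=> /(mulIf pi20)/eqP; rewrite eqr_nat => /eqP/val_inj/enum_val_inj.
- move=> j; split; first by rewrite /freq divr_ge0 ?(ltW T0) // mulr_ge0 // mulrn_wge0 // pi_ge0.
  move=> t; have qj : 0 < rnorm (q (enum_val j)).
    rewrite lt_neqAle rnorm_ge0 andbT eq_sym.
    by apply: contra_neq (qn0 j); exact: rnorm_eq0.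
  (* (cos (t a) - cos (t b_j)) q_j = - (C t - cos (a t)) q_j, of norm at most m |q_j|. *)
  rewrite -(ler_pM2r qj) -rnormZr.
  rewrite (_ : _ *: _ = - ((C t - (cos (a * t))%:C%C%:A) * q (enum_val j))).
    by rewrite rnormN (le_trans (rnormM _ _)) // ler_wpM2r.
  by rewrite mulrBl Cq mulr_algl opprB rmorphB scalerBl [a * t]mulrC [freq _ _ * t]mulrC.
- move=> t; rewrite -[LHS]mulr1 -qsum mulr_sumr.
  by apply: eq_bigr => j _; rewrite Cq.
Qed.

(** Multiplication by p_j reads off the j-th coordinate, whence injectivity and multiplicativity.
    The generated algebra lies in the range because the range is a closed subalgebra containing
    every C t. *)
Lemma subalg_gen_orth (C : R -> AB) k (p : 'I_k -> AB) (b : 'I_k -> R) :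
  (forall j, closed_subalg_gen B (range C) (p j)) ->
  (forall j, p j != 0) -> (forall j, p j * p j = p j) ->
  (forall i j, i != j -> p i * p j = 0) -> \sum_j p j = 1 ->
  (forall t, C t = \sum_j (cos (b j * t))%:C%C *: p j) ->
  alg_iso_onto B (fun u : 'rV[Cplx R]_k => \sum_j u 0 j *: p j : A)
    (closed_subalg_gen B (range C)).
Proof.
move=> pgen p0 pp pq p1 Cp.
set f := fun u : 'rV[Cplx R]_k => _.
have fp u j : (f u : AB) * p j = u 0 j *: p j.
  rewrite /f mulr_suml (bigD1 j) //= big1 ?addr0 => [|i ij].
    by rewrite -scalerAl pp.
  by rewrite -scalerAl pq // scaler0.
have fD u v : f (u + v) = f u + f v.
  by rewrite /f -big_split; apply: eq_bigr => j _; rewrite mxE scalerDl.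
have fZ (c : Cplx R) u : f (c *: u) = c *: f u.
  by rewrite /f scaler_sumr; apply: eq_bigr => j _; rewrite mxE scalerA.
have fM (u v : 'rV_k) : f (\row_i (u 0 i * v 0 i)) = (f u : AB) * f v.
  rewrite [in RHS]/f mulr_sumr; apply: eq_bigr => j _.
  by rewrite mxE -scalerAr fp scalerA mulrC.
have f1 : f (const_mx 1) = 1 :> AB.
  by rewrite /f -p1; apply: eq_bigr => j _; rewrite mxE scale1r.
have fI : injective f.
  move=> u v uv; apply/rowP => j; apply/eqP; rewrite -subr_eq0.
  have /eqP : (u 0 j - v 0 j) *: p j = 0 by rewrite scalerBl -!fp uv subrr.
  by rewrite scaler_eq0 (negPf (p0 j)) orbF.
split=> //; split=> //; split=> //; split=> //; split=> //.
apply/seteqP; split=> [_ [u _ <-] S cS SS CS|x].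
  by apply: subalg_sum => // j; have [_ [_ [SZ _]]] := SS; apply: SZ; exact: (pgen j S cS SS CS).
apply.
(* If y is a limit of points of the range, y p_j is a limit of multiples of p_j, hence such a
   multiple by [line_closed]; and y is the sum of the y p_j. *)
- apply: (@rnorm_closed _ _ B) => y yf.
  have yp j : exists c : Cplx R, (y : AB) * p j = c *: p j.
    apply: line_closed => // e e0.
    have pj : 0 < rnorm (p j) + 1 by rewrite ltr_wpDl.
    have [_ [u _ <-] ye] := yf _ (divr_gt0 e0 pj).
    exists (u 0 j); rewrite -fp -mulrBl (le_lt_trans (rnormM _ _)) //.
    rewrite ltr_pdivlMr // in ye; apply: le_lt_trans ye.
    by rewrite ler_wpM2l // lerDl.
  have [c Hc] := choice yp.
  exists (\row_j c j) => //; rewrite /f -[RHS](mulr1 (y : AB)) -p1 mulr_sumr.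
  by apply: eq_bigr => j _; rewrite mxE Hc.
- split; first by exists (const_mx 1).
  split; first by move=> _ _ [u _ <-] [v _ <-]; exists (u + v); rewrite ?fD.
  split; first by move=> c _ [u _ <-]; exists (c *: u); rewrite ?fZ.
  by move=> _ _ [u _ <-] [v _ <-]; exists (\row_i (u 0 i * v 0 i)); rewrite ?fM.
- move=> _ [t _ <-]; exists (\row_j (cos (b j * t))%:C%C) => //.
  by rewrite /f Cp; apply: eq_bigr => j _; rewrite mxE.
Qed.

End Decomposition.

Theorem theorem3p6 (R : realType) (A : completeNormedModType (Cplx R))
  (B : banach_algebra A) (C : R -> A) :
  is_cosine_function B C ->
  (forall a m : R,
     (forall t : R, `|C t - (cos (a * t))%:C%C *: bone B| <= m%:C%C) ->
     (forall m' : R,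
        (forall t : R, `|C t - (cos (a * t))%:C%C *: bone B| <= m'%:C%C) -> m <= m') ->
     m < 2 ->
     exists (k : nat) (f : 'rV[Cplx R]_k -> A) (p : 'I_k -> A) (b : 'I_k -> R),
       alg_iso_onto B f (closed_subalg_gen B (range C)) /\
       (forall j, closed_subalg_gen B (range C) (p j)) /\
       orth_idempotents B p /\
       injective b /\ (forall j, Omega a m (b j)) /\
       (forall t : R, C t = \sum_(j < k) (cos (b j * t))%:C%C *: p j)) /\
  (forall a : R,
     (exists m : R, m < 8 / (3 * Num.sqrt 3) /\
        (forall t : R, `|C t - (cos (a * t))%:C%C *: bone B| <= m%:C%C)) ->
     forall t : R, C t = (cos (a * t))%:C%C *: bone B).
Proof.
move=> [C0 CD]; split.
  move=> a m Cm _ m2.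
  have Cclose t : rnorm ((C t : balg R A B) - (cos (a * t))%:C%C%:A) <= m.
    by rewrite -rnorm_le; exact: Cm.
  have [k [p [b [[pgen p0 pp pq p1] bI bO Cp]]]] :=
    cosine_decomposition B C a m C0 CD m2 Cclose.
  (* Injectivity of [b] into [Omega a m] carries the bound of [k] by the cardinality. *)
  exists k, (fun u => \sum_j u 0 j *: p j), p, b.
  split; first exact: (subalg_gen_orth B C k p b).
  by split=> //; split.
move=> a [m [mb Cm]].
have s30 : 0 < Num.sqrt 3 :> R by rewrite sqrtr_gt0.
have m2 : m < 2.
  have s3 : Num.sqrt 3 ^+ 2 = 3 :> R by rewrite sqr_sqrtr.
  rewrite (lt_le_trans mb) // ler_pdivrMr ?mulr_gt0 //; nra.
have Cclose t : rnorm ((C t : balg R A B) - (cos (a * t))%:C%C%:A) <= m.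
  by rewrite -rnorm_le; exact: Cm.
have [k [p [b [[_ _ _ _ p1] _ bO Cp]]]] :=
  cosine_decomposition B C a m C0 CD m2 Cclose.
(* Frequencies in [Omega] are nonnegative, hence the comparison with |a|; a different one would
   break the bound [m] at the [t] given by [cos_sup_dist]. *)
have bE j : b j = `|a|.
  apply/eqP/negPn/negP => bja; have [bj0 Hb] := bO j.
  have [|t] := cos_sup_dist `|a| (b j) (normr_ge0 a) bj0; first by rewrite eq_sym.
  have -> : cos (t * `|a|) = cos (t * a).
    by rewrite -cos_norm -[in RHS]cos_norm !normrM normr_id.
  by rewrite leNgt (le_lt_trans (Hb t) mb).
move=> t; rewrite [LHS]Cp -[bone B]p1 [RHS]scaler_sumr; apply: eq_bigr => j _.
by rewrite bE -cos_norm normrM normr_id -normrM cos_norm.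
Qed.
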